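(* For every $g\in\mathfrak F_m$ and all $f_1,f_2\in\mathcal A_{(n,m)}$, the functions $f_j\circ\mathrm L(g)$ belong to $\mathcal A_{(n,m)}$ and $$\big(f_1\circ\mathrm L(g)\big)\ast_{(n,m)}\big(f_2\circ\mathrm L(g)\big)=(f_1\ast_{(n,m)}f_2)\circ\mathrm L(g).$$
   Context: Throughout, $(n,m)$ is one of $(2,2),(3,4),(5,8)$ and $\hbar>0$ is a parameter. For $\mathbf z,\mathbf w\in\mathbb C^k$ write $\mathbf z\cdot\mathbf w=\sum_{s=1}^k z_s\overline{w_s}$ and $|\mathbf z|^2=\mathbf z\cdot\mathbf z$. The map $\rho_{(n,m)}=(\rho_1,\dots,\rho_{n+1}):\mathbb C^m\to\mathbb C^{n+1}$ is defined by: for $(2,2)$: $\rho_1=\tfrac12(z_2^2-z_1^2)$, $\rho_2=\tfrac{i}{2}(z_1^2+z_2^2)$, $\rho_3=z_1z_2$; for $(3,4)$: $\rho_1=z_1z_3+z_2z_4$, $\rho_2=i(z_1z_3-z_2z_4)$, $\rho_3=i(z_1z_4+z_2z_3)$, $\rho_4=z_1z_4-z_2z_3$; for $(5,8)$: $\rho_1=i(-z_1z_6+z_3z_8+z_2z_5-z_4z_7)$, $\rho_2=z_1z_6+z_3z_8+z_2z_5+z_4z_7$, $\rho_3=z_2z_6+z_3z_7-z_1z_5-z_4z_8$, $\rho_4=i(-z_1z_5+z_4z_8-z_2z_6+z_3z_7)$, $\rho_5=i(-z_1z_8-z_2z_7-z_3z_6-z_4z_5)$, $\rho_6=z_1z_8+z_2z_7-z_3z_6-z_4z_5$.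 $S^n\subset\mathbb R^{n+1}$ is the unit sphere with normalized surface measure $d\Omega$ and $\langle\phi,\psi\rangle_{S^n}=\int_{S^n}\phi\overline\psi\,d\Omega$. For $\boldsymbol\alpha\in\mathbb C^{n+1}$ the coherent state is $\Phi^{(\hbar)}_{\boldsymbol\alpha}(\mathbf x)=\sum_{\ell\ge0}\frac{\sqrt{2\ell+n-1}}{\ell!\sqrt{n-1}}\big(\frac{\mathbf x\cdot\boldsymbol\alpha}{\hbar}\big)^\ell$, $\mathbf x\in S^n$. The measure on $\mathbb C^m$ is $d\mu_m(\mathbf z)=(\pi\hbar)^{-m}e^{-|\mathbf z|^2/\hbar}\,d\mathbf z\,d\overline{\mathbf z}$. The kernel is $\mathbf Q^{(\hbar)}_m(\mathbf z,\mathbf w)=\langle \Phi^{(\hbar)}_{\rho_{(n,m)}(\mathbf w)},\Phi^{(\hbar)}_{\rho_{(n,m)}(\mathbf z)}\rangle_{S^n}$. For a bounded operator $A$ on $L^2(S^n)$, its Berezin symbol is $\mathfrak B(A)(\mathbf z)=\frac{\langle A\Phi_{\rho(\mathbf z)},\Phi_{\rho(\mathbf z)}\rangle_{S^n}}{\langle \Phi_{\rho(\mathbf z)},\Phi_{\rho(\mathbf z)}\rangle_{S^n}}$ and its extended Berezin symbol is $\mathfrak B(A)(\mathbf w,\mathbf z)=\frac{\langle A\Phi_{\rho(\mathbf z)},\Phi_{\rho(\mathbf w)}\rangle_{S^n}}{\langle \Phi_{\rho(\mathbf z)},\Phi_{\rho(\mathbf w)}\rangle_{S^n}}$ (with $\Phi_{\rho(\mathbf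 z)}=\Phi^{(\hbar)}_{\rho_{(n,m)}(\mathbf z)}$), defined where the denominator is nonzero. $\mathcal A_{(n,m)}=\{\mathfrak B(A): A\in\mathbf B(L^2(S^n))\}$. For $f_1,f_2\in\mathcal A_{(n,m)}$ with extended symbols $f_j(\cdot,\cdot)$, the star product is $(f_1\ast_{(n,m)}f_2)(\mathbf z)=\int_{\mathbb C^m}f_1(\mathbf z,\mathbf u)f_2(\mathbf u,\mathbf z)\frac{|\mathbf Q_m^{(\hbar)}(\mathbf u,\mathbf z)|^2}{\mathbf Q_m^{(\hbar)}(\mathbf z,\mathbf z)}\,d\mu_m(\mathbf u)$. The groups are $\mathfrak F_2=\mathrm{SU}(2)$, $\mathfrak F_4=\mathrm{SU}(2)\times\mathrm{SU}(2)$, $\mathfrak F_8=\mathrm{SU}(4)$, acting on $\mathbb C^m$ by $\mathbf z\mapsto\mathrm L(g)\mathbf z$ with: $\mathrm L(g)=g$ for $g\in\mathrm{SU}(2)$ ($m=2$); $\mathrm L(g)=\begin{pmatrix}V&0\\0&W\end{pmatrix}$ for $g=(V,W)$ ($m=4$); $\mathrm L(g)=\begin{pmatrix}U&0\\0&EUE\end{pmatrix}$ for $g=U\in\mathrm{SU}(4)$ ($m=8$), where $E=\begin{pmatrix}0&0&-1&0\\0&0&0&1\\-1&0&0&0\\0&1&0&0\end{pmatrix}$. *)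

(* Defs.v *)
From HB Require Import structures.
From mathcomp Require Import all_boot all_order all_algebra.
From mathcomp Require Import all_classical all_reals all_analysis.
From mathcomp Require Import complex.
Unset Printing Implicit Defensive.
Import Order.TTheory GRing.Theory Num.Theory.
Import numFieldNormedType.Exports.
Local Open Scope ring_scope.
Local Open Scope classical_set_scope.
Local Open Scope complex_scope.

(** The three cases (n,m) = (2,2), (3,4), (5,8). *)
Inductive nm_case := C22 | C34 | C58.
Definition ndim (c : nm_case) : nat := match c with C22 => 2 | C34 => 3 | C58 => 5 end.
Definition mdim (c : nm_case) : nat := match c with C22 => 2 | C34 => 4 | C58 => 8 end.

Section Defs.
Variable R : realType.
Local Notation C := R[i].

(* ---------- Lebesgue integration on R^k (points are nat -> R, coords 0..k-1, others 0) *)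
Fixpoint eint (k : nat) (f : (nat -> R) -> \bar R) : \bar R :=
  match k with
  | 0 => f (fun _ => 0)
  | k'.+1 => (\int[@lebesgue_measure R]_t
                 eint k' (fun v => f (fun i => if i is j.+1 then v j else t)))%E
  end.

Definition rint (k : nat) (f : (nat -> R) -> R) : R :=
  fine (eint k (fun x => (Num.max (f x) 0)%:E)) - fine (eint k (fun x => (Num.max (- f x) 0)%:E)).

Definition cint (k : nat) (F : (nat -> R) -> C) : C :=
  (rint k (fun x => complex.Re (F x)) +i* rint k (fun x => complex.Im (F x)))%C.

Definition nrmsq (k : nat) (x : nat -> R) : R := \sum_(j < k) x j ^+ 2.

Definition nrm (k : nat) (x : nat -> R) : nat -> R :=
  fun i => if (i < k)%N then x i / Num.sqrt (nrmsq k x) else 0.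

Definition gauss (k : nat) (x : nat -> R) : R := expR (- nrmsq k x / 2).

(* normalized surface measure on S^n = law of x/|x| for standard Gaussian x in R^(n+1) *)
Definition sint (n : nat) (F : (nat -> R) -> C) : C :=
  cint n.+1 (fun x => F (nrm n.+1 x) * (gauss n.+1 x)%:C) / (rint n.+1 (gauss n.+1))%:C.

Definition ip (n : nat) (phi psi : (nat -> R) -> C) : C :=
  sint n (fun x => phi x * (psi x)^*).

Definition l2norm (n : nat) (phi : (nat -> R) -> C) : R :=
  Num.sqrt (complex.Re (ip n phi phi)).

Definition sqmod (z : C) : R := complex.Re z ^+ 2 + complex.Im z ^+ 2.

Definition cylG (k : nat) : set (set (nat -> R)) :=
  fun A => exists i (B : set R), [/\ (i < k)%N, measurable B & A = (fun x => x i) @^-1` B].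

Definition kmeas (k : nat) (f : (nat -> R) -> R) : Prop :=
  forall B : set R, measurable B -> <<s cylG k >> (f @^-1` B).

Definition L2 (n : nat) (phi : (nat -> R) -> C) : Prop :=
  [/\ kmeas n.+1 (fun x => complex.Re (phi (nrm n.+1 x))),
      kmeas n.+1 (fun x => complex.Im (phi (nrm n.+1 x))) &
      (eint n.+1 (fun x => (sqmod (phi (nrm n.+1 x)) * gauss n.+1 x)%:E) < +oo)%E].

Definition bounded_op (n : nat) (A : ((nat -> R) -> C) -> ((nat -> R) -> C)) : Prop :=
  [/\ forall phi, L2 n phi -> L2 n (A phi),
      forall (a : C) phi psi, L2 n phi -> L2 n psi ->
        l2norm n (fun x => A (fun y => a * phi y + psi y) x - (a * A phi x + A psi x)) = 0 &
      exists K : R, forall phi, L2 n phi -> l2norm n (A phi) <= K * l2norm n phi].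

(* ---------- coherent states *)
Definition csum (u : nat -> C) : C :=
  (limn ((series (fun l => complex.Re (u l) : R)) : R^nat) +i* limn ((series (fun l => complex.Im (u l) : R)) : R^nat))%C.

Definition dotx {n : nat} (x : nat -> R) (a : 'cV[C]_n.+1) : C :=
  \sum_(s < n.+1) (x s)%:C * (a s 0)^*.

Definition ccoef (n l : nat) : R :=
  Num.sqrt ((2 * l + n - 1)%N%:R) / ((l`!)%:R * Num.sqrt ((n - 1)%N%:R)).

Definition Phi {n : nat} (hbar : R) (a : 'cV[C]_n.+1) : (nat -> R) -> C :=
  fun x => csum (fun l => (ccoef n l)%:C * (dotx x a / hbar%:C) ^+ l).

(* ---------- the maps rho *)
Definition crd {k : nat} (z : 'cV[C]_k) (s : nat) : C :=
  match (insub s.-1 : option 'I_k) with Some i => z i 0 | None => 0 end.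

Definition rho_comp (c : nm_case) {k : nat} (z : 'cV[C]_k) (j : nat) : C :=
  let Z := crd z in
  let I := ('i)%C in
  match c with
  | C22 => match j with
           | 1 => 2^-1 * (Z 2 ^+ 2 - Z 1 ^+ 2)
           | 2 => I / 2 * (Z 1 ^+ 2 + Z 2 ^+ 2)
           | 3 => Z 1 * Z 2
           | _ => 0 end
  | C34 => match j with
           | 1 => Z 1 * Z 3 + Z 2 * Z 4
           | 2 => I * (Z 1 * Z 3 - Z 2 * Z 4)
           | 3 => I * (Z 1 * Z 4 + Z 2 * Z 3)
           | 4 => Z 1 * Z 4 - Z 2 * Z 3
           | _ => 0 end
  | C58 => match j with
           | 1 => I * (- (Z 1 * Z 6) + Z 3 * Z 8 + Z 2 * Z 5 - Z 4 * Z 7)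
           | 2 => Z 1 * Z 6 + Z 3 * Z 8 + Z 2 * Z 5 + Z 4 * Z 7
           | 3 => Z 2 * Z 6 + Z 3 * Z 7 - Z 1 * Z 5 - Z 4 * Z 8
           | 4 => I * (- (Z 1 * Z 5) + Z 4 * Z 8 - Z 2 * Z 6 + Z 3 * Z 7)
           | 5 => I * (- (Z 1 * Z 8) - Z 2 * Z 7 - Z 3 * Z 6 - Z 4 * Z 5)
           | 6 => Z 1 * Z 8 + Z 2 * Z 7 - Z 3 * Z 6 - Z 4 * Z 5
           | _ => 0 end
  end.

Definition rho (c : nm_case) (z : 'cV[C]_(mdim c)) : 'cV[C]_(ndim c).+1 :=
  \col_(j < (ndim c).+1) rho_comp c z j.+1.

(* ---------- kernel, Berezin symbols, star product *)
Definition PhiR (c : nm_case) (hbar : R) (z : 'cV[C]_(mdim c)) := Phi hbar (rho c z).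

Definition Qk (c : nm_case) (hbar : R) (z w : 'cV[C]_(mdim c)) : C :=
  ip (ndim c) (PhiR c hbar w) (PhiR c hbar z).

Definition ext_symbol (c : nm_case) (hbar : R) (A : ((nat -> R) -> C) -> ((nat -> R) -> C))
  (w z : 'cV[C]_(mdim c)) : C :=
  ip (ndim c) (A (PhiR c hbar z)) (PhiR c hbar w) / ip (ndim c) (PhiR c hbar z) (PhiR c hbar w).

Definition symbol (c : nm_case) (hbar : R) (A : ((nat -> R) -> C) -> ((nat -> R) -> C))
  (z : 'cV[C]_(mdim c)) : C := ext_symbol c hbar A z z.

Definition in_A (c : nm_case) (hbar : R) (f : 'cV[C]_(mdim c) -> C) : Prop :=
  exists A, bounded_op (ndim c) A /\ f = symbol c hbar A.

Definition toCv (k : nat) (x : nat -> R) : 'cV[C]_k :=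
  \col_(s < k) (x (2 * s)%N +i* x (2 * s).+1)%C.

(* integral against d mu_m = (pi hbar)^-m e^{-|z|^2/hbar} (Lebesgue on R^{2m}) *)
Definition mu_int {m : nat} (hbar : R) (F : 'cV[C]_m -> C) : C :=
  ((pi * hbar) ^- m)%:C *
  cint (2 * m) (fun x => F (toCv m x) * (expR (- nrmsq (2 * m) x / hbar))%:C).

Definition star (c : nm_case) (hbar : R) (f1 f2 : 'cV[C]_(mdim c) -> 'cV[C]_(mdim c) -> C)
  (z : 'cV[C]_(mdim c)) : C :=
  mu_int hbar (fun u => f1 z u * f2 u z * (Qk c hbar u z * (Qk c hbar u z)^* / Qk c hbar z z)).

(* ---------- the groups F_m and their action L *)
Definition adjmx {k : nat} (U : 'M[C]_k) : 'M[C]_k := (map_mx (fun z => z^*) U)^T.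
Definition is_SU {k : nat} (U : 'M[C]_k) : Prop := U *m adjmx U = 1%:M /\ \det U = 1.

Definition Fgrp (c : nm_case) : Type :=
  match c with C22 => 'M[C]_2 | C34 => ('M[C]_2 * 'M[C]_2)%type | C58 => 'M[C]_4 end.

Definition in_F (c : nm_case) : Fgrp c -> Prop :=
  match c return Fgrp c -> Prop with
  | C22 => fun g => is_SU g
  | C34 => fun g => is_SU g.1 /\ is_SU g.2
  | C58 => fun g => is_SU g
  end.

Definition Eent (i j : nat) : C :=
  match i, j with 0, 2 => -1 | 1, 3 => 1 | 2, 0 => -1 | 3, 1 => 1 | _, _ => 0 end.
Definition Emx : 'M[C]_4 := \matrix_(i < 4, j < 4) Eent i j.

Definition Lmat (c : nm_case) : Fgrp c -> 'M[C]_(mdim c) :=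
  match c return Fgrp c -> 'M[C]_(mdim c) with
  | C22 => fun g => g
  | C34 => fun g => block_mx g.1 0 0 g.2
  | C58 => fun U => block_mx U 0 0 (Emx *m U *m Emx)
  end.

Definition Lact (c : nm_case) (g : Fgrp c) (z : 'cV[C]_(mdim c)) : 'cV[C]_(mdim c) :=
  Lmat c g *m z.

End Defs.

(* Main.v *)
(* For g in the group, rho (L g z) = M (rho z) with M real orthogonal, so
   composition with M is a unitary operator T of L^2(S^n) carrying the coherent
   state at z to the one at L g z.  Conjugating A by T gives an operator whose
   extended symbol at (w, z) is that of A at (L g w, L g z), and the Gaussian
   measure on C^m is invariant under L g, which yields the covariance of the
   star product for this choice of operators.  For arbitrary operators with the
   same symbols one needs that a symbol determines its extended symbol: a bounded
   sesquilinear form vanishing on all pairs (Phi_z, Phi_z) vanishes on all pairs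
   (Phi_z, Phi_w).  Indeed its homogeneous components along z -> t z are
   polynomials in conj z and z that vanish on the diagonal, hence vanish after
   polarization. *)
Require Import Defs.
From HB Require Import structures.
From mathcomp Require Import all_boot all_order all_fingroup all_algebra.
From mathcomp Require Import all_classical all_reals all_analysis.
From mathcomp Require Import measurable_realfun complex.
From mathcomp Require Import ring lra zify.
Import Order.TTheory GRing.Theory Num.Theory.
Import numFieldNormedType.Exports.
Local Open Scope ring_scope.
Local Open Scope classical_set_scope.

(** * Iterated Lebesgue integrals and orthogonal changes of variables *)

Section IteratedIntegral.
Context {R : realType}.

(** The integrals are iterated one-dimensional Lebesgue integrals over sequences, so invariance
    under orthogonal maps is derived from Tonelli, affine substitution in one variable and an LUP
    factorization. It is proved for nonnegative functions with extended real values and passes to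
    positive and negative parts; for the star product, measurability of the integrand is then
    enough, and convergence never enters. Functions on the sphere are not taken modulo null
    functions: operators are linear only up to a function of norm 0, which Cauchy-Schwarz makes
    invisible to inner products. That rho (L g z) is a real orthogonal image of rho z reflects the
    covers SU(2) -> SO(3), SU(2) x SU(2) -> SO(4) and SU(4) -> SO(6). Since rho is quadratic, z -> t
    z with t real multiplies the term of bidegree (l, k) on the diagonal by t^(2(l+k)); only the sum
    over a fixed total degree can be isolated there, and a second scaling, of z alone, separates the
    bidegrees after polarization. *)

Definition cyl (k : nat) : measurableType (cylG R k).-sigma :=
  g_sigma_algebraType (cylG R k).

Definition consf (t : R) (v : nat -> R) : nat -> R :=
  fun i => if i is j.+1 then v j else t.

Lemma eintS k f :
  eint R k.+1 f = (\int[@lebesgue_measure R]_t eint R k (fun v => f (consf t v)))%E.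
Proof. by []. Qed.

Lemma kmeasP k (f : (nat -> R) -> R) :
  kmeas R k f <-> measurable_fun [set: cyl k] (f : cyl k -> R).
Proof.
split => [h _ B mB|h B mB]; first by rewrite setTI; exact: h.
by have := h measurableT B mB; rewrite setTI.
Qed.

Lemma measurable_cyl d (X : measurableType d) k (h : X -> cyl k) :
  (forall i, (i < k)%N -> measurable_fun setT (fun x => h x i)) ->
  measurable_fun setT h.
Proof.
move=> mh; apply: (@measurability _ _ X (cyl k) setT h (cylG R k)) => //.
move=> _ [_ [i [B [ik mB ->]]] <-].
exact: (mh i ik measurableT B mB).
Qed.

Lemma measurable_coord k i : (i < k)%N ->
  measurable_fun setT (fun v : cyl k => v i).
Proof.
move=> ik _ B mB; rewrite setTI; apply: sub_sigma_algebra.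
by exists i, B.
Qed.

Lemma measurable_consf k :
  measurable_fun setT (fun p : measurableTypeR R * cyl k => consf p.1 p.2 : cyl k.+1).
Proof.
apply: measurable_cyl => -[|i] /= ik; first exact: measurable_fst.
apply: (measurableT_comp (measurable_coord k i ik)); exact: measurable_snd.
Qed.

Lemma measurable_consfr k (t : R) :
  measurable_fun setT (fun v : cyl k => consf t v : cyl k.+1).
Proof.
by apply: measurable_cyl => -[|i] ik /=; [exact: measurable_cst|exact: measurable_coord].
Qed.

Lemma eint_ge0 k (f : (nat -> R) -> \bar R) :
  (forall x, (0 <= f x)%E) -> (0 <= eint R k f)%E.
Proof.
elim: k f => [|k IH] f f0 //=.
by apply: integral_ge0 => t _; exact: IH.
Qed.

(** The parameter space X is arbitrary so that the induction can move each integration variable into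
    it; Tonelli then integrates that variable out. *)
Lemma measurable_eint k d (X : measurableType d) (F : X * cyl k -> \bar R) :
  (forall p, (0 <= F p)%E) -> measurable_fun setT F ->
  measurable_fun setT (fun x => eint R k (fun v => F (x, v))).
Proof.
elim: k d X F => [|k IH] d X F F0 mF.
  apply: (@measurableT_comp _ _ _ _ _ _ F setT (fun x => (x, (fun=> 0) : cyl 0)) mF).
  exact: pair2_measurable.
pose G (p : (X * measurableTypeR R) * cyl k) := F (p.1.1, consf p.1.2 p.2).
have mG : measurable_fun setT G.
  apply: (measurableT_comp mF); apply: measurable_fun_pair => /=.
    by apply: measurableT_comp => //; exact: measurable_fst.
  apply: measurable_cyl => -[|i] ik /=.
    by apply: measurableT_comp => //; exact: measurable_fst.
  by apply: (measurableT_comp (measurable_coord k i ik)); exact: measurable_snd.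
have mH := IH _ _ G (fun p => F0 _) mG.
apply: (@measurable_fun_fubini_tonelli_F _ _ _ _ _ (@lebesgue_measure R)
  (fun p => eint R k (fun v => G (p, v)))) => //.
by move=> p; apply: eint_ge0 => v; exact: F0.
Qed.

Lemma measurable_eint_cons k (f : cyl k.+1 -> \bar R) :
  (forall x, (0 <= f x)%E) -> measurable_fun setT f ->
  measurable_fun setT (fun t : measurableTypeR R => eint R k (fun v => f (consf t v))).
Proof.
move=> f0 mf.
apply: (measurable_eint k _ _ (fun p : measurableTypeR R * cyl k => f (consf p.1 p.2))).
  by [].
exact: (measurableT_comp mf (measurable_consf k)).
Qed.

Lemma eq_eint k (f g : (nat -> R) -> \bar R) : f =1 g -> eint R k f = eint R k g.
Proof. by move=> /funext ->. Qed.

Lemma eintD k (f g : cyl k -> \bar R) :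
  (forall x, (0 <= f x)%E) -> (forall x, (0 <= g x)%E) ->
  measurable_fun setT f -> measurable_fun setT g ->
  (eint R k (fun x => f x + g x) = eint R k f + eint R k g)%E.
Proof.
elim: k f g => [//|k IH] f g f0 g0 mf mg /=.
rewrite -ge0_integralD //=.
- apply: eq_integral => t _; apply: IH => //.
  + exact: (measurableT_comp mf (measurable_consfr k t)).
  + exact: (measurableT_comp mg (measurable_consfr k t)).
- by move=> t _; exact: eint_ge0.
- exact: measurable_eint_cons.
- by move=> t _; exact: eint_ge0.
- exact: measurable_eint_cons.
Qed.

Lemma eintZl k (c : R) (f : cyl k -> \bar R) : 0 <= c ->
  (forall x, (0 <= f x)%E) -> measurable_fun setT f ->
  (eint R k (fun x => c%:E * f x) = c%:E * eint R k f)%E.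
Proof.
move=> c0; elim: k f => [//|k IH] f f0 mf /=.
rewrite -ge0_integralZl_EFin //=.
- apply: eq_integral => t _; apply: IH => //.
  exact: (measurableT_comp mf (measurable_consfr k t)).
- by move=> t _; exact: eint_ge0.
- exact: measurable_eint_cons.
Qed.

Lemma le_eint k (f g : cyl k -> \bar R) :
  (forall x, (0 <= f x)%E) -> (forall x, (f x <= g x)%E) ->
  measurable_fun setT f -> measurable_fun setT g ->
  (eint R k f <= eint R k g)%E.
Proof.
elim: k f g => [|k IH] f g f0 fg mf mg /=; first exact: fg.
have g0 x : (0 <= g x)%E by apply: le_trans (f0 x) (fg x).
apply: ge0_le_integral => //=.
- by move=> t _; exact: eint_ge0.
- exact: measurable_eint_cons.
- exact: measurable_eint_cons.
- move=> t _; apply: IH => //.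
  + exact: (measurableT_comp mf (measurable_consfr k t)).
  + exact: (measurableT_comp mg (measurable_consfr k t)).
Qed.

Lemma measurable_affine (a b : R) : measurable_fun setT (fun t : measurableTypeR R => a * t + b : measurableTypeR R).
Proof.
apply: measurable_funD => //; exact: measurable_funM.
Qed.

(** Lebesgue measure is determined by its values on half-open intervals, so it is compared there
    with its image under t -> a t + b, scaled by |a|. *)
Lemma ge0_integral_affine (a b : R) (h : measurableTypeR R -> \bar R) : a != 0 ->
  (forall t, (0 <= h t)%E) -> measurable_fun setT h ->
  (\int[@lebesgue_measure R]_t h t = `|a|%:E * \int[@lebesgue_measure R]_t h (a * t + b)%R)%E.
Proof.
move=> a0 h0 mh.
have na : 0 < `|a| by rewrite normr_gt0.
pose nnga := NngNum (ltW na).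
have mf := measurable_affine a b.
pose m0 := mscale nnga (pushforward (@lebesgue_measure R) (fun t : measurableTypeR R => a * t + b : measurableTypeR R)).
pose m := m0 mf.
have mE : forall A, measurable A -> @lebesgue_measure R A = m A.
  apply: lebesgue_measure_unique => _ [[x y] _ <-] /=.
  (* The preimage of ]x, y]; a negative a exchanges the endpoints and hence the closed side. *)
  pose I : set R := if 0 < a then `](x - b) / a, (y - b) / a]%classic
      else `[(y - b) / a, (x - b) / a[%classic.
  transitivity (`|a|%:E * @lebesgue_measure R I)%E; rewrite /I; last first.
    congr (_ * _)%E; rewrite /pushforward; congr lebesgue_measure.
    apply/seteqP; split => t /=; case: ifPn => ha; rewrite /= !in_itv /=.
    - by rewrite ltr_pdivrMr // ler_pdivlMr // ltrBlDr lerBrDr mulrC.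
    - have ha' : a < 0 by rewrite lt_neqAle a0 /= leNgt.
      by rewrite ltr_ndivlMr // ler_ndivrMr // ltrBlDr lerBrDr mulrC => /andP[-> ->].
    - by rewrite ltr_pdivrMr // ler_pdivlMr // ltrBlDr lerBrDr mulrC.
    - have ha' : a < 0 by rewrite lt_neqAle a0 /= leNgt.
      by rewrite ltr_ndivlMr // ler_ndivrMr // ltrBlDr lerBrDr mulrC => /andP[-> ->].
  case: ifPn => ha; rewrite !lebesgue_measure_itv /= !lte_fin.
    rewrite ltr_pM2r ?invr_gt0 // ltrD2r; case: ifPn => _; last by rewrite mule0.
    rewrite -!EFinD -EFinM; congr EFin.
    rewrite gtr0_norm //; field; exact: a0.
  have ha' : a < 0 by rewrite lt_neqAle a0 /= leNgt.
  rewrite ltr_nM2r ?invr_lt0 // ltrD2r; case: ifPn => _; last by rewrite mule0.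
  rewrite -!EFinD -EFinM; congr EFin.
  rewrite ltr0_norm //; field; exact: a0.
rewrite (eq_measure_integral m) => [|A mA _]; last exact: mE.
rewrite ge0_integral_mscale //= ge0_integral_pushforward //.
Qed.

(** The shift b is there for the induction in [eint_lowaff]: once the outermost variable is fixed,
    its contributions to the later rows become constants. *)
Definition lowaff (L : nat -> nat -> R) (b : nat -> R) (k : nat) (x : nat -> R) : nat -> R :=
  fun i => if (i < k)%N then \sum_(j < i.+1) L i j * x j + b i else 0.

Lemma measurable_lowaff L b k : measurable_fun setT (fun x : cyl k => lowaff L b k x : cyl k).
Proof.
apply: measurable_cyl => i ik; rewrite /lowaff ik.
apply: measurable_funD => //; apply: measurable_sum => j.
by apply: measurable_funM => //; apply: measurable_coord; apply: leq_trans (ltn_ord j) _.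
Qed.

Lemma eint_lowaff k L b (f : cyl k -> \bar R) :
  (forall i, (i < k)%N -> L i i != 0) ->
  (forall x, (0 <= f x)%E) -> measurable_fun setT f ->
  eint R k f = ((\prod_(i < k) `|L i i|)%:E * eint R k (fun x => f (lowaff L b k x)))%E.
Proof.
elim: k L b f => [|k IH] L b f L0 f0 mf.
  by rewrite big_ord0 mul1e.
rewrite !eintS (ge0_integral_affine (L 0%N 0%N) (b 0%N)); first last.
- exact: measurable_eint_cons.
- by move=> t; exact: eint_ge0.
- exact: L0.
rewrite big_ord_recl EFinM -muleA; congr (_ * _)%E.
rewrite -ge0_integralZl_EFin //; first last.
- exact/prodr_ge0.
- apply: (measurable_eint_cons k (fun x => f (lowaff L b k.+1 x))) => //.
  exact: (measurableT_comp mf (measurable_lowaff L b k.+1)).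
- by move=> t _; apply: eint_ge0.
apply: eq_integral => t _.
rewrite (IH (fun i j => L i.+1 j.+1) (fun i => L i.+1 0%N * t + b i.+1)) //; first last.
- exact: (measurableT_comp mf (measurable_consfr k _)).
- by move=> i ik; exact: L0.
congr (_ * _)%E; apply: eq_eint => v; congr f; apply/funext => -[|i] /=.
  by rewrite /lowaff /= big_ord_recl big_ord0 addr0.
rewrite /lowaff /= ltnS; case: ifP => // ik.
by rewrite addrA; congr (_ + _); rewrite [RHS]big_ord_recl addrC.
Qed.

(** [eint] evaluates its integrand only at sequences that vanish from index k on. This reconciles
    [mxact], which truncates, with maps that do not. *)
Lemma eq_eint_supp k (f g : (nat -> R) -> \bar R) :
  (forall x, (forall i, (k <= i)%N -> x i = 0) -> f x = g x) ->
  eint R k f = eint R k g.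
Proof.
elim: k f g => [|k IH] f g fg /=; first by apply: fg.
apply: eq_integral => t _; apply: IH => v v0; apply: fg => -[|i] //= ik.
exact: v0.
Qed.

Definition swapc (i : nat) (x : nat -> R) : nat -> R :=
  fun j => x (if j == i then i.+1 else if j == i.+1 then i else j).

(** Exchanging the two outermost variables is Tonelli; deeper swaps reduce to it under the integral
    signs. *)
Lemma eint_swapc k i (f : cyl k -> \bar R) : (i.+1 < k)%N ->
  (forall x, (0 <= f x)%E) -> measurable_fun setT f ->
  eint R k f = eint R k (fun x => f (swapc i x)).
Proof.
elim: k i f => [//|k IH] [|i] f ik f0 mf.
  case: k {IH} ik f f0 mf => [//|k] _ f f0 mf /=.
  pose g (p : measurableTypeR R * measurableTypeR R) :=
    eint R k (fun v => f (consf p.1 (consf p.2 v))).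
  rewrite (fubini_tonelli g) /=.
  - apply: eq_integral => s _; apply: eq_integral => t _.
    by apply: eq_eint => v; congr f; apply/funext => -[|[|j]].
  - apply: (measurable_eint k _ _ (fun q : (measurableTypeR R * measurableTypeR R) * cyl k =>
        f (consf q.1.1 (consf q.1.2 q.2)))) => //.
    apply: (measurableT_comp mf); apply: measurable_cyl => -[|[|j]] jk /=.
    + by apply: measurableT_comp => //; exact: measurable_fst.
    + by apply: measurableT_comp => //; exact: measurable_fst.
    + by apply: (measurableT_comp (measurable_coord k j jk)); exact: measurable_snd.
  - by move=> p; exact: eint_ge0.
rewrite !eintS; apply: eq_integral => t _.
rewrite (IH i) //; last exact: (measurableT_comp mf (measurable_consfr k t)).
apply: eq_eint => v; congr f; apply/funext => -[|j] //=.
by rewrite /swapc !eqSS; case: ifP => // _; case: ifP.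
Qed.

(** * Linear changes of variables *)

Definition mxact k (M : 'M[R]_k) (x : nat -> R) : nat -> R :=
  fun i => if insub i is Some j then \sum_(l < k) M j l * x l else 0.

Lemma mxact_ord k (M : 'M[R]_k) x (i : 'I_k) : mxact k M x i = \sum_(l < k) M i l * x l.
Proof. by rewrite /mxact valK. Qed.

Lemma mxact_lt k (M : 'M[R]_k) x i (ik : (i < k)%N) :
  mxact k M x i = \sum_(l < k) M (Ordinal ik) l * x l.
Proof. exact: (mxact_ord k M x (Ordinal ik)). Qed.

Lemma mxact_out k (M : 'M[R]_k) x i : (k <= i)%N -> mxact k M x i = 0.
Proof. by move=> ki; rewrite /mxact insubF // ltnNge ki. Qed.

Lemma mxact_comp k (M N : 'M[R]_k) x : mxact k (M *m N) x = mxact k M (mxact k N x).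
Proof.
apply/funext => i; have [ik|ki] := ltnP i k; last by rewrite !mxact_out.
rewrite !mxact_lt.
under eq_bigr do rewrite mxE mulr_suml.
rewrite exchange_big /=; apply: eq_bigr => j _; rewrite mxact_ord mulr_sumr.
by apply: eq_bigr => l _; rewrite mulrA.
Qed.

Lemma mxact1 k x : (forall i, (k <= i)%N -> x i = 0) -> mxact k 1%:M x = x.
Proof.
move=> x0; apply/funext => i; have [ik|ki] := ltnP i k; last by rewrite mxact_out // x0.
rewrite mxact_lt (bigD1 (Ordinal ik)) //= mxE eqxx mul1r.
by rewrite big1 ?addr0 // => j; rewrite mxE eq_sym => /negPf ->; rewrite mul0r.
Qed.

Lemma measurable_act k (M : 'M[R]_k) :
  measurable_fun setT (fun x : cyl k => mxact k M x : cyl k).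
Proof.
apply: measurable_cyl => i ik.
under eq_fun do rewrite mxact_lt.
apply: measurable_sum => j; apply: measurable_funM => //.
exact: measurable_coord.
Qed.

(** The substitution rule is made a predicate on matrices because it is stable under products, which
    reduces it to triangular and permutation matrices. *)
Definition jacobian k (M : 'M[R]_k) :=
  forall f : cyl k -> \bar R, (forall x, (0 <= f x)%E) -> measurable_fun setT f ->
  eint R k f = (`|\det M|%:E * eint R k (fun x => f (mxact k M x)))%E.

Lemma jacobianM k (M N : 'M[R]_k) : jacobian k M -> jacobian k N -> jacobian k (M *m N).
Proof.
move=> jM jN f f0 mf; rewrite jM // (jN (fun x => f (mxact k M x))) //.
  rewrite det_mulmx normrM EFinM muleA; congr (_ * _)%E.
  by apply: eq_eint => x; rewrite mxact_comp.
exact: (measurableT_comp mf (measurable_act k M)).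
Qed.

Lemma jacobian1 k : jacobian k 1%:M.
Proof.
move=> f f0 mf; rewrite det1 normr1 mul1e.
by apply: eq_eint_supp => x x0; rewrite mxact1.
Qed.

Lemma jacobian_trig n (L : 'M[R]_n.+1) : is_trig_mx L -> \det L != 0 -> jacobian n.+1 L.
Proof.
move=> trL; rewrite det_trig // => dL f f0 mf.
pose l i j : R := L (inord i) (inord j).
have dl i : (i < n.+1)%N -> l i i != 0.
  move=> ik; move: dL; rewrite prodf_seq_neq0 => /allP /(_ (inord i)).
  by rewrite mem_index_enum => /(_ isT).
rewrite (eint_lowaff n.+1 l (fun=> 0) f) //; congr (_ * _)%E.
  by rewrite det_trig // normr_prod; congr EFin; apply: eq_bigr => i _; rewrite /l inord_val.
apply: eq_eint => x; congr f; apply/funext => i.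
rewrite /lowaff; case: ifP => ik; last by rewrite mxact_out // leqNgt ik.
rewrite addr0 mxact_lt.
rewrite (big_ord_widen n.+1 (fun j => l i j * x j) ik) [RHS](bigID (fun j : 'I_n.+1 => (j < i.+1)%N)) /=.
rewrite [X in _ + X]big1 ?addr0.
  apply: eq_bigr => j _; rewrite /l inord_val; congr (L _ _ * _).
  by apply: val_inj; rewrite /= inordK.
move=> j; rewrite -leqNgt => ij; have /is_trig_mxP -> := trL; last exact: ij.
by rewrite mul0r.
Qed.

Lemma jacobian_adjacent k (i j : 'I_k) : j = i.+1 :> nat -> jacobian k (perm_mx (tperm i j)).
Proof.
move=> ij f f0 mf; have ik : (i.+1 < k)%N by rewrite -ij.
rewrite det_perm normr_sign mul1e (eint_swapc k i) //.
apply: eq_eint_supp => x x0; congr f; apply/funext => l.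
have [lk|kl] := ltnP l k; last first.
  rewrite mxact_out // /swapc.
  by rewrite !gtn_eqF ?x0 // (leq_trans _ kl) // ltnW.
rewrite mxact_lt (bigD1 (tperm i j (Ordinal lk))) //= !mxE eqxx mul1r big1 ?addr0; last first.
  by move=> s; rewrite !mxE eq_sym => /negPf ->; rewrite mul0r.
rewrite /swapc; congr x; case: tpermP => [/(congr1 val)|/(congr1 val)|] /=.
- by move=> ->; rewrite eqxx.
- by move=> ->; rewrite ij eqxx gtn_eqF.
- move=> /eqP; rewrite -val_eqE /= => /negPf -> /eqP; rewrite -val_eqE /= ij.
  by move=> /negPf ->.
Qed.

(** Induction on the distance j - i: conjugation by the adjacent transposition of j - 1 and j
    shortens it by one. *)
Lemma jacobian_tperm k (i j : 'I_k) : jacobian k (perm_mx (tperm i j)).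
Proof.
wlog ij : i j / (i < j)%N.
  move=> H; have [|ji|/val_inj ->] := ltngtP i j; first exact: H.
    by rewrite tpermC; exact: H.
  by rewrite tperm1 perm_mx1; exact: jacobian1.
have [d dj] : exists d, (nat_of_ord j - i = d)%N by exists (j - i)%N.
elim: d j ij dj => [|d IH] j ij dj.
  by move/eqP: dj; rewrite subn_eq0 leqNgt ij.
have [jS|jS] := eqVneq (nat_of_ord j) i.+1; first exact: jacobian_adjacent.
have j'k : (j.-1 < k)%N by apply: leq_ltn_trans (leq_pred _) (ltn_ord j).
pose j' := Ordinal j'k.
have jj' : nat_of_ord j = j'.+1 by rewrite /= prednK // (leq_trans _ ij).
have ij' : (i < j')%N by rewrite -ltnS -jj' ltn_neqAle eq_sym jS.
have -> : tperm i j = (tperm j' j * tperm i j' * tperm j' j)%g.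
  have <- : (tperm i j' ^ tperm j' j)%g = tperm i j.
    rewrite tpermJ tpermL tpermD // -val_eqE /= gtn_eqF //.
  by rewrite conjgE tpermV mulgA.
rewrite !perm_mxM; apply: jacobianM; first apply: jacobianM.
- exact: jacobian_adjacent.
- by apply: IH => //; lia.
- exact: jacobian_adjacent.
Qed.

Lemma jacobian_perm k (s : 'S_k) : jacobian k (perm_mx s).
Proof.
have [ts -> _] := prod_tpermP s; elim: ts => [|t ts IH].
  by rewrite big_nil perm_mx1; exact: jacobian1.
by rewrite big_cons perm_mxM; apply: jacobianM => //; exact: jacobian_tperm.
Qed.

(* LUP decomposition; reversing the order of the coordinates makes the upper
   triangular factor lower triangular. *)
Lemma jacobian_unit n (A : 'M[R]_n.+1) : \det A != 0 -> jacobian n.+1 A.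
Proof.
move=> dA; have := cormen_lup_correct A; have := cormen_lup_perm A.
have := cormen_lup_detL A; have := @cormen_lup_lower _ _ A; have := @cormen_lup_upper _ _ A.
case: cormen_lup => -[P L] U /= upU lowL dL /existsP[s /eqP ->] PA.
have AE : A = perm_mx s^-1 *m (L *m U).
  have PA' : perm_mx s *m A = L *m U := PA.
  by rewrite -PA' mulmxA -perm_mxM mulVg perm_mx1 mul1mx.
have dU : \det U != 0.
  move: dA; rewrite AE !det_mulmx dL mul1r mulf_eq0 negb_or.
  by case/andP.
pose w : 'S_n.+1 := perm (@rev_ord_inj n.+1).
have ww : (w * w = 1)%g by apply/permP => i; rewrite permM !permE rev_ordK.
have UE : U = perm_mx w *m (perm_mx w *m U *m perm_mx w) *m perm_mx w.
  by rewrite !mulmxA -perm_mxM ww perm_mx1 mul1mx -mulmxA -perm_mxM ww perm_mx1 mulmx1.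
rewrite AE; apply: jacobianM; first exact: jacobian_perm.
apply: jacobianM.
  apply: jacobian_trig; last by rewrite dL oner_eq0.
  by apply/is_trig_mxP => i j ij; rewrite lowL ?(ltnW ij) // -val_eqE /= ltn_eqF.
rewrite UE; apply: jacobianM; last exact: jacobian_perm.
apply: jacobianM; first exact: jacobian_perm.
apply: jacobian_trig.
  have wV : (w^-1 = w)%g by apply: (mulgI w); rewrite mulgV ww.
  have -> : perm_mx w *m U *m perm_mx w = col_perm w (row_perm w U).
    by rewrite col_permE row_permE wV.
  apply/is_trig_mxP => i j ij; rewrite !mxE !permE.
  by apply: upU; rewrite /=; have := ltn_ord j; lia.
by rewrite !det_mulmx !det_perm !mulf_neq0 // signr_eq0.
Qed.

(** Polarization: comparing the norms of e_i + e_j and of its image yields the (i, j) entry of M^T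
    M. *)
Lemma nrmsq_act_ortho k (M : 'M[R]_k) :
  (forall x, nrmsq R k (mxact k M x) = nrmsq R k x) -> M^T *m M = 1%:M.
Proof.
move=> H; pose e (i : 'I_k) (j : nat) : R := (j == i)%:R.
have eE i (l : 'I_k) : e i l = (l == i)%:R by [].
have ae i (l : 'I_k) : mxact k M (e i) l = M l i.
  rewrite mxact_ord (bigD1 i) //= eE eqxx mulr1 big1 ?addr0 // => j /negPf ji.
  by rewrite eE ji mulr0.
have aD x y (l : 'I_k) : mxact k M (fun j => x j + y j) l = mxact k M x l + mxact k M y l.
  by rewrite !mxact_ord -big_split; apply: eq_bigr => j _; rewrite mulrDr.
have sqD (x y : nat -> R) : nrmsq R k (fun j => x j + y j) =
    nrmsq R k x + nrmsq R k y + 2 * \sum_(j < k) x j * y j.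
  rewrite /nrmsq mulr_sumr -!big_split; apply: eq_bigr => j _ /=.
  ring.
apply/matrixP => i j; rewrite !mxE.
have := H (fun l => e i l + e j l).
have -> : nrmsq R k (mxact k M (fun l => e i l + e j l)) =
   nrmsq R k (fun l => mxact k M (e i) l + mxact k M (e j) l).
  by apply: eq_bigr => l _; rewrite aD.
rewrite !sqD !H => /addrI /(mulfI (_ : 2 != 0)) => /(_ _)/wrap[].
  by rewrite pnatr_eq0.
under eq_bigr do rewrite !ae.
under [in RHS]eq_bigr do rewrite !eE.
move=> E; under eq_bigr do rewrite mxE.
rewrite E (bigD1 i) //= eqxx mul1r big1 ?addr0 // => l /negPf li.
by rewrite li mul0r.
Qed.

Lemma eint_isometry n (M : 'M[R]_n.+1) (f : cyl n.+1 -> \bar R) :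
  (forall x, nrmsq R n.+1 (mxact n.+1 M x) = nrmsq R n.+1 x) ->
  (forall x, (0 <= f x)%E) -> measurable_fun setT f ->
  eint R n.+1 (fun x => f (mxact n.+1 M x)) = eint R n.+1 f.
Proof.
move=> /nrmsq_act_ortho MM f0 mf.
have d2 : \det M ^+ 2 = 1 by rewrite expr2 -{1}det_tr -det_mulmx MM det1.
have d1 : `|\det M| = 1.
  by apply/eqP; rewrite -(@eqrXn2 _ 2) // ?normr_ge0 // expr1n real_normK ?num_real // d2.
rewrite [in RHS](jacobian_unit n M) // ?d1 ?mul1e //.
by rewrite -normr_eq0 d1 oner_eq0.
Qed.

End IteratedIntegral.

(** * Integrable functions on R^k *)

Section RealIntegral.
Context {R : realType}.
Implicit Types (f g a b : (nat -> R) -> R).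

Lemma eint_mxact k (M : 'M[R]_k) (f : cyl k -> \bar R) :
  (forall x, nrmsq R k (mxact k M x) = nrmsq R k x) ->
  (forall x, (0 <= f x)%E) -> measurable_fun setT f ->
  eint R k (fun x => f (mxact k M x)) = eint R k f.
Proof.
case: k M f => [|n] M f MM f0 mf; last exact: eint_isometry.
by congr f; apply/funext => i; rewrite mxact_out.
Qed.

Lemma kmeas_cst k (c : R) : kmeas R k (fun=> c).
Proof. by apply/kmeasP; exact: measurable_cst. Qed.

Lemma kmeasD k f g : kmeas R k f -> kmeas R k g -> kmeas R k (fun x => f x + g x).
Proof. by move=> /kmeasP mf /kmeasP mg; apply/kmeasP; exact: measurable_funD. Qed.

Lemma kmeasM k f g : kmeas R k f -> kmeas R k g -> kmeas R k (fun x => f x * g x).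
Proof. by move=> /kmeasP mf /kmeasP mg; apply/kmeasP; exact: measurable_funM. Qed.

Lemma kmeasN k f : kmeas R k f -> kmeas R k (fun x => - f x).
Proof. by move=> /kmeasP mf; apply/kmeasP; exact: measurableT_comp. Qed.

Lemma kmeasB k f g : kmeas R k f -> kmeas R k g -> kmeas R k (fun x => f x - g x).
Proof. by move=> mf mg; apply: kmeasD => //; exact: kmeasN. Qed.

Lemma kmeasX k f n : kmeas R k f -> kmeas R k (fun x => f x ^+ n).
Proof. by move=> /kmeasP mf; apply/kmeasP; exact: measurable_funX. Qed.

Lemma kmeas_norm k f : kmeas R k f -> kmeas R k (fun x => `|f x|).
Proof. by move=> /kmeasP mf; apply/kmeasP; exact: measurableT_comp. Qed.

Lemma kmeas_max k f g : kmeas R k f -> kmeas R k g -> kmeas R k (fun x => Num.max (f x) (g x)).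
Proof. by move=> /kmeasP mf /kmeasP mg; apply/kmeasP; exact: measurable_maxr. Qed.

Lemma kmeas_sum k (I : Type) (s : seq I) (h : I -> (nat -> R) -> R) :
  (forall i, kmeas R k (h i)) -> kmeas R k (fun x => \sum_(i <- s) h i x).
Proof.
by move=> mh; apply/kmeasP; apply: measurable_sum => i; exact/kmeasP.
Qed.

Lemma kmeas_expR k f : kmeas R k f -> kmeas R k (fun x => expR (f x)).
Proof. by move=> /kmeasP mf; apply/kmeasP; exact: (measurableT_comp (@measurable_expR R)). Qed.

Lemma kmeas_powR k f p : kmeas R k f -> kmeas R k (fun x => f x `^ p).
Proof. by move=> /kmeasP mf; apply/kmeasP; exact: (measurableT_comp (measurable_powR p)). Qed.

(** The real power with exponent -1 is measurable and agrees with the inverse on [0, +oo[, including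
    the convention 0^-1 = 0. *)
Lemma kmeas_inv k f : (forall x, 0 <= f x) -> kmeas R k f -> kmeas R k (fun x => (f x)^-1).
Proof.
move=> f0 mf; have -> : (fun x => (f x)^-1) = (fun x => f x `^ (-1)).
  by apply/funext => x; rewrite powR_inv1.
exact: kmeas_powR.
Qed.

Lemma kmeas_sqrt k f : (forall x, 0 <= f x) -> kmeas R k f -> kmeas R k (fun x => Num.sqrt (f x)).
Proof.
move=> f0 mf; have -> : (fun x => Num.sqrt (f x)) = (fun x => f x `^ 2^-1).
  by apply/funext => x; rewrite powR12_sqrt.
exact: kmeas_powR.
Qed.

Lemma kmeas_coord k i : (i < k)%N -> kmeas R k (fun x => x i).
Proof. by move=> ik; apply/kmeasP; exact: measurable_coord. Qed.

Lemma kmeas_cvg k (h : nat -> (nat -> R) -> R) f :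
  (forall m, kmeas R k (h m)) -> (forall x, h ^~ x @ \oo --> f x) -> kmeas R k f.
Proof.
move=> mh hf; apply/kmeasP; apply: (@measurable_fun_cvg _ (cyl k) R setT h f).
- by move=> m; exact/kmeasP.
- by move=> x _; exact: hf.
Qed.

Lemma kmeas_mxact k (M : 'M[R]_k) f : kmeas R k f -> kmeas R k (fun x => f (mxact k M x)).
Proof.
move=> /kmeasP mf; apply/kmeasP.
exact: (measurableT_comp mf (measurable_act k M)).
Qed.

Lemma nrmsq_ge0 k x : 0 <= nrmsq R k x.
Proof. by apply: sumr_ge0 => i _; exact: sqr_ge0. Qed.

Lemma kmeas_nrmsq k : kmeas R k (nrmsq R k).
Proof.
by apply: kmeas_sum => i; apply: kmeasX; apply: kmeas_coord.
Qed.

Lemma kmeas_nrm k i : kmeas R k (fun x => nrm R k x i).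
Proof.
rewrite /nrm; case ik: (i < k)%N; last exact: kmeas_cst.
apply: kmeasM; first exact: kmeas_coord.
apply: (kmeas_inv k (fun x => Num.sqrt (nrmsq R k x))) => [x|]; first exact: sqrtr_ge0.
apply: (kmeas_sqrt k (nrmsq R k)); [exact: nrmsq_ge0|exact: kmeas_nrmsq].
Qed.

Lemma kmeas_gauss k : kmeas R k (gauss R k).
Proof.
apply: kmeas_expR; apply: kmeasM; last exact: kmeas_cst.
by apply: kmeasN; exact: kmeas_nrmsq.
Qed.

Lemma gauss_ge0 k x : 0 <= gauss R k x. Proof. exact: expR_ge0. Qed.

Definition efin f : (nat -> R) -> \bar R := fun x => (f x)%:E.

Lemma kmeas_efin k f : kmeas R k f -> measurable_fun setT (efin f : cyl k -> \bar R).
Proof. by move=> /kmeasP mf; apply/measurable_EFinP. Qed.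

Definition itg k f := kmeas R k f /\ (eint R k (fun x => `|f x|%:E) < +oo)%E.

Lemma le_itg k f g : kmeas R k f -> (forall x, `|f x| <= g x) -> itg k g -> itg k f.
Proof.
move=> mf fg [mg ig]; split => //; apply: le_lt_trans ig.
apply: le_eint => [x|x||]; rewrite ?lee_fin //.
- by apply: le_trans (fg x) _; exact: ler_norm.
- by apply: kmeas_efin; exact: kmeas_norm.
- by apply: kmeas_efin; exact: kmeas_norm.
Qed.

Lemma itgD k f g : itg k f -> itg k g -> itg k (fun x => f x + g x).
Proof.
move=> [mf If] [mg Ig]; apply: (@le_itg _ _ (fun x => `|f x| + `|g x|)).
- exact: kmeasD.
- by move=> x; exact: ler_normD.
split; first by apply: kmeasD; exact: kmeas_norm.
rewrite (_ : (fun _ => _) = fun x => (`|f x|%:E + `|g x|%:E)%E); last first.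
  by apply/funext => x; rewrite ger0_norm ?EFinD // addr_ge0.
rewrite eintD ?lte_add_pinfty //.
- by apply: kmeas_efin; exact: kmeas_norm.
- by apply: kmeas_efin; exact: kmeas_norm.
Qed.

Lemma itgZ k (c : R) f : itg k f -> itg k (fun x => c * f x).
Proof.
move=> [mf If]; split; first by apply: kmeasM => //; exact: kmeas_cst.
rewrite (_ : (fun _ => _) = fun x => (`|c|%:E * `|f x|%:E)%E); last first.
  by apply/funext => x; rewrite normrM EFinM.
rewrite eintZl ?lte_mul_pinfty //.
by apply: kmeas_efin; exact: kmeas_norm.
Qed.

Definition fint k f : R := fine (eint R k (efin f)).

Lemma eint_fin k f : itg k f -> (forall x, 0 <= f x) -> eint R k (efin f) \is a fin_num.
Proof.
move=> [mf If] f0; rewrite ge0_fin_numE; last by apply: eint_ge0 => x; rewrite lee_fin.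
by apply: le_lt_trans If; rewrite le_eqVlt; apply/orP; left; apply/eqP; apply: eq_eint => x;
  rewrite ger0_norm.
Qed.

Lemma fintD k f g : itg k f -> itg k g -> (forall x, 0 <= f x) -> (forall x, 0 <= g x) ->
  fint k (fun x => f x + g x) = fint k f + fint k g.
Proof.
move=> If Ig f0 g0; rewrite /fint -fineD ?eint_fin // -eintD //.
- exact: kmeas_efin If.1.
- exact: kmeas_efin Ig.1.
Qed.

Lemma fintZ k (c : R) f : 0 <= c -> itg k f -> (forall x, 0 <= f x) ->
  fint k (fun x => c * f x) = c * fint k f.
Proof.
move=> c0 If f0; rewrite /fint -[c in RHS]/(fine c%:E) -fineM ?eint_fin // -eintZl //.
exact: kmeas_efin If.1.
Qed.

Lemma le_fint k f g : itg k f -> itg k g -> (forall x, 0 <= f x) -> (forall x, f x <= g x) ->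
  fint k f <= fint k g.
Proof.
move=> If Ig f0 fg; have g0 x : 0 <= g x by apply: le_trans (f0 x) (fg x).
apply: fine_le; rewrite ?eint_fin //; apply: le_eint => //.
- exact: kmeas_efin If.1.
- exact: kmeas_efin Ig.1.
Qed.

Lemma itg_pos k f : itg k f -> itg k (fun x => Num.max (f x) 0).
Proof.
move=> If; apply: (@le_itg _ _ (fun x => `|f x|)).
- by apply: kmeas_max; [exact: If.1|exact: kmeas_cst].
- by move=> x; case: (lerP 0 (f x)) => h; rewrite ?normr0.
- split; first exact: kmeas_norm If.1.
  by under eq_fun do rewrite normr_id; exact: If.2.
Qed.

Lemma itgN k f : itg k f -> itg k (fun x => - f x).
Proof.
move=> [mf If]; split; first exact: kmeasN.
by under eq_fun do rewrite normrN.
Qed.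

Lemma maxrN0 (r : R) : Num.max r 0 - Num.max (- r) 0 = r.
Proof.
have [r0|r0] := lerP r 0; first by rewrite max_l ?oppr_ge0 // sub0r opprK.
by rewrite (max_r (x := - r)) ?subr0 // oppr_le0 ltW.
Qed.

Lemma max0_ge0 (r : R) : 0 <= Num.max r 0.
Proof. by rewrite le_max lexx orbT. Qed.
#[local] Hint Resolve max0_ge0 : core.

(** Writing f+ and f- for the positive and negative parts of f, a + f- = b + f+ is an identity
    between nonnegative functions, where additivity is available. Linearity of [rint] follows by
    choosing a and b suitably. *)
Lemma rint_diff k f a b : itg k a -> itg k b -> (forall x, 0 <= a x) -> (forall x, 0 <= b x) ->
  (forall x, f x = a x - b x) -> rint R k f = fint k a - fint k b.
Proof.
move=> Ia Ib a0 b0 fab.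
have If : itg k f.
  rewrite (_ : f = fun x => a x + - b x); last exact/funext.
  by apply: itgD => //; exact: itgN.
have Ip := itg_pos _ _ If; have In := itg_pos _ _ (itgN _ _ If).
apply/eqP; rewrite subr_eq -/(fint k _) addrAC -subr_eq opprK; apply/eqP.
rewrite -!fintD //.
congr (fine (eint R k (efin _))); apply/funext => x; rewrite fab.
by have := maxrN0 (a x - b x); lra.
Qed.

Lemma rintE k f : (forall x, 0 <= f x) -> rint R k f = fint k f.
Proof.
move=> f0; rewrite /rint /fint.
rewrite [X in _ - fine X](_ : _ = 0%E) ?subr0 /=.
  by congr (fine (eint R k _)); apply/funext => x; rewrite /efin max_l.
have -> : (fun x => (Num.max (- f x) 0)%:E) = (fun=> 0%E).
  by apply/funext => x; rewrite max_r // oppr_le0.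
elim: k => [//|k IH] /=.
by under eq_integral do rewrite IH; rewrite integral0.
Qed.

Lemma rintD k f g : itg k f -> itg k g ->
  rint R k (fun x => f x + g x) = rint R k f + rint R k g.
Proof.
move=> If Ig; have Ipf := itg_pos _ _ If; have Inf := itg_pos _ _ (itgN _ _ If).
have Ipg := itg_pos _ _ Ig; have Ing := itg_pos _ _ (itgN _ _ Ig).
rewrite (rint_diff k _ (fun x => Num.max (f x) 0 + Num.max (g x) 0)
  (fun x => Num.max (- f x) 0 + Num.max (- g x) 0)).
- by rewrite !fintD // /rint -!/(fint k _); ring.
- exact: itgD.
- exact: itgD.
- by move=> x; exact: addr_ge0.
- by move=> x; exact: addr_ge0.
- by move=> x; rewrite -{1}(maxrN0 (f x)) -{1}(maxrN0 (g x)); ring.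
Qed.

Lemma rintN k f : itg k f -> rint R k (fun x => - f x) = - rint R k f.
Proof.
move=> If; rewrite /rint opprB; congr (_ - fine (eint R k _)).
by apply/funext => x; rewrite opprK.
Qed.

Lemma rintZ k (c : R) f : itg k f -> rint R k (fun x => c * f x) = c * rint R k f.
Proof.
move=> If; wlog c0 : c / 0 <= c.
  move=> H; have [|/ltW c0] := lerP 0 c; first exact: H.
  rewrite -[in RHS](opprK c) mulNr -H ?oppr_ge0 // -rintN; last exact: itgZ.
  by congr rint; apply/funext => x; rewrite mulNr opprK.
have Ipf := itg_pos _ _ If; have Inf := itg_pos _ _ (itgN _ _ If).
rewrite (rint_diff k _ (fun x => c * Num.max (f x) 0) (fun x => c * Num.max (- f x) 0)).
- by rewrite !fintZ // -mulrBr.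
- exact: itgZ.
- exact: itgZ.
- by move=> x; exact: mulr_ge0.
- by move=> x; exact: mulr_ge0.
- by move=> x; rewrite -{1}(maxrN0 (f x)); ring.
Qed.

Lemma fint_ge0 k f : (forall x, 0 <= f x) -> 0 <= fint k f.
Proof. by move=> f0; apply: fine_ge0; apply: eint_ge0 => x; rewrite lee_fin. Qed.

(** Both parts are invariant as extended reals, so the equality persists even when the integrals
    diverge. *)
Lemma rint_mxact k (M : 'M[R]_k) f :
  (forall x, nrmsq R k (mxact k M x) = nrmsq R k x) -> kmeas R k f ->
  rint R k (fun x => f (mxact k M x)) = rint R k f.
Proof.
move=> MM mf.
rewrite /rint; congr (fine _ - fine _).
- apply: (eint_mxact k M (efin (fun x => Num.max (f x) 0))) => [//|x|]; first by rewrite lee_fin.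
  by apply: kmeas_efin; apply: kmeas_max => //; exact: kmeas_cst.
- apply: (eint_mxact k M (efin (fun x => Num.max (- f x) 0))) => [//|x|]; first by rewrite lee_fin.
  by apply: kmeas_efin; apply: kmeas_max; [exact: kmeasN|exact: kmeas_cst].
Qed.

Lemma itg_gauss k : itg k (gauss R k).
Proof.
split; first exact: kmeas_gauss.
under eq_fun do rewrite ger0_norm ?gauss_ge0 //.
elim: k => [|k IH]; first by rewrite /= ltry.
have gE t v : gauss R k.+1 (consf t v) = expR (- t ^+ 2 / 2) * gauss R k v.
  by rewrite /gauss /nrmsq big_ord_recl -expRD; congr expR; rewrite /=; ring.
rewrite eintS.
under eq_integral => t _.
  under eq_fun do rewrite gE EFinM.
  rewrite eintZl ?expR_ge0 //; last first.
    by apply: kmeas_efin; exact: kmeas_gauss.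
    by move=> x; rewrite lee_fin gauss_ge0.
  over.
have mh : measurable_fun setT (fun t : measurableTypeR R => (expR (- t ^+ 2 / 2))%:E).
  apply/measurable_EFinP; apply: (measurableT_comp (@measurable_expR R)).
  by apply: measurable_funM => //; apply: measurableT_comp => //; exact: measurable_funX.
rewrite ge0_integralZr //; last by apply: eint_ge0 => x; rewrite lee_fin gauss_ge0.
apply: lte_mul_pinfty => //.
  by apply: integral_ge0 => t _; rewrite lee_fin expR_ge0.
have s2 : (Num.sqrt 2 : R) != 0 by rewrite sqrtr_eq0 -ltNge ltr0n.
rewrite ge0_fin_numE; last by apply: integral_ge0 => t _; rewrite lee_fin expR_ge0.
(* The substitution by a factor sqrt 2 turns exp(-t^2/2) into [gauss_fun], whose integrability is
   known. *)
rewrite (ge0_integral_affine (Num.sqrt 2) 0) //.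
apply: lte_mul_pinfty => //.
have /integrableP[_] := @integrableT_gauss R.
apply: le_lt_trans; rewrite le_eqVlt; apply/orP; left; apply/eqP.
apply: eq_integral => t _; rewrite /= ger0_norm ?gauss_fun_ge0 //.
congr ((expR _)%:E); rewrite addr0 exprMn sqr_sqrtr ?ler0n //.
by field.
Qed.

End RealIntegral.

(** * Square-integrable functions on the sphere *)

Local Open Scope complex_scope.

Section SquareIntegrable.
Context {R : realType} {n : nat}.
Notation C := R[i].
Notation Re := complex.Re.
Notation Im := complex.Im.
Notation N := (nrm R n.+1).
Notation G := (gauss R n.+1).
Implicit Types (phi psi chi : (nat -> R) -> C) (x : nat -> R).

Lemma cReD (z w : C) : Re (z + w) = Re z + Re w. Proof. by case: z; case: w. Qed.
Lemma cImD (z w : C) : Im (z + w) = Im z + Im w. Proof. by case: z; case: w. Qed.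
Lemma cReN (z : C) : Re (- z) = - Re z. Proof. by case: z. Qed.
Lemma cImN (z : C) : Im (- z) = - Im z. Proof. by case: z. Qed.
Lemma cReM (z w : C) : Re (z * w) = Re z * Re w - Im z * Im w.
Proof. by case: z; case: w. Qed.
Lemma cImM (z w : C) : Im (z * w) = Re z * Im w + Im z * Re w.
Proof. by case: z => a b; case: w => c d. Qed.
Lemma cReJ (z : C) : Re z^* = Re z. Proof. by case: z. Qed.
Lemma cImJ (z : C) : Im z^* = - Im z. Proof. by case: z. Qed.
Lemma complexP (z w : C) : Re z = Re w -> Im z = Im w -> z = w.
Proof. by case: z => a b; case: w => c d /= -> ->. Qed.

Definition cE := (cReD, cImD, cReN, cImN, cReM, cImM, cReJ, cImJ).

Lemma sqmod_ge0 (z : C) : 0 <= sqmod R z.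
Proof. by rewrite addr_ge0 // sqr_ge0. Qed.

Lemma sqmodM (z w : C) : sqmod R (z * w) = sqmod R z * sqmod R w.
Proof. by rewrite /sqmod !cE; ring. Qed.

Lemma L2_itg phi : L2 R n phi -> itg n.+1 (fun x => sqmod R (phi (N x)) * G x).
Proof.
move=> [mr mi fin]; split; last first.
  under eq_fun do rewrite ger0_norm ?mulr_ge0 ?sqmod_ge0 ?gauss_ge0 //.
  exact: fin.
apply: kmeasM; last exact: kmeas_gauss.
by apply: kmeasD; exact: kmeasX.
Qed.

Lemma itg_L2 phi : kmeas R n.+1 (fun x => Re (phi (N x))) ->
  kmeas R n.+1 (fun x => Im (phi (N x))) ->
  itg n.+1 (fun x => sqmod R (phi (N x)) * G x) -> L2 R n phi.
Proof.
move=> mr mi [_]; under eq_fun do rewrite ger0_norm ?mulr_ge0 ?sqmod_ge0 ?gauss_ge0 //.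
by split.
Qed.

Lemma L2_bounded phi (B : R) : kmeas R n.+1 (fun x => Re (phi (N x))) ->
  kmeas R n.+1 (fun x => Im (phi (N x))) ->
  (forall x, sqmod R (phi (N x)) <= B) -> L2 R n phi.
Proof.
move=> mr mi hB; apply: itg_L2 => //.
apply: (@le_itg _ _ _ (fun x => B * G x)); last by apply: itgZ; exact: itg_gauss.
  apply: kmeasM; last exact: kmeas_gauss.
  by apply: kmeasD; exact: kmeasX.
move=> x; rewrite ger0_norm ?mulr_ge0 ?sqmod_ge0 ?gauss_ge0 //.
by apply: ler_wpM2r => //; exact: gauss_ge0.
Qed.

Lemma L2_lin (a : C) phi psi : L2 R n phi -> L2 R n psi ->
  L2 R n (fun x => a * phi x + psi x).
Proof.
move=> Lp Lq; have [mr mi _] := Lp; have [mr' mi' _] := Lq.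
have mR : kmeas R n.+1 (fun x => Re (a * phi (N x) + psi (N x))).
  under eq_fun do rewrite !cE.
  by apply: kmeasD => //; apply: kmeasB; apply: kmeasM => //; exact: kmeas_cst.
have mI : kmeas R n.+1 (fun x => Im (a * phi (N x) + psi (N x))).
  under eq_fun do rewrite !cE.
  by apply: kmeasD => //; apply: kmeasD; apply: kmeasM => //; exact: kmeas_cst.
apply: itg_L2 => //.
(* |a phi + psi|^2 <= 2 |a phi|^2 + 2 |psi|^2. *)
apply: (@le_itg _ _ _ (fun x => 2 * sqmod R a * (sqmod R (phi (N x)) * G x) +
  2 * (sqmod R (psi (N x)) * G x))).
- apply: kmeasM; last exact: kmeas_gauss.
  by apply: kmeasD; apply: kmeasX.
- move=> x; rewrite ger0_norm ?mulr_ge0 ?sqmod_ge0 ?gauss_ge0 //.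
  rewrite !mulrA -mulrDl; apply: ler_wpM2r; first exact: gauss_ge0.
  rewrite -mulrA -sqmodM; move: (a * _) (psi _) => [b c] [d e].
  rewrite /sqmod /=; have := sqr_ge0 (b - d); have := sqr_ge0 (c - e).
  by rewrite !sqrrB !sqrrD; lra.
- by apply: itgD; apply: itgZ; exact: L2_itg.
Qed.

Lemma L2_0 : L2 R n (fun=> 0).
Proof.
apply: (@L2_bounded _ 0); rewrite /=; try exact: kmeas_cst.
by move=> x; rewrite /sqmod /= expr0n addr0.
Qed.

Lemma L2Z (a : C) phi : L2 R n phi -> L2 R n (fun x => a * phi x).
Proof.
move=> Lp; have := L2_lin a _ _ Lp L2_0.
by under eq_fun do rewrite addr0.
Qed.

Lemma L2D phi psi : L2 R n phi -> L2 R n psi -> L2 R n (fun x => phi x + psi x).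
Proof.
move=> Lp Lq; have := L2_lin 1 _ _ Lp Lq.
by under eq_fun do rewrite mul1r.
Qed.

Lemma L2B phi psi : L2 R n phi -> L2 R n psi -> L2 R n (fun x => phi x - psi x).
Proof.
move=> Lp Lq; have := L2_lin (-1) _ _ Lq Lp.
by under eq_fun do rewrite mulN1r addrC.
Qed.

Lemma L2_sum (I : Type) (s : seq I) (e : I -> (nat -> R) -> C) :
  (forall i, L2 R n (e i)) -> L2 R n (fun x => \sum_(i <- s) e i x).
Proof.
move=> Le; elim: s => [|i s IH].
  by under eq_fun do rewrite big_nil; exact: L2_0.
by under eq_fun do rewrite big_cons; exact: L2D.
Qed.

Lemma itg_Re_ip phi psi : L2 R n phi -> L2 R n psi ->
  itg n.+1 (fun x => Re (phi (N x) * (psi (N x))^*) * G x).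
Proof.
move=> Lp Lq; have [mr mi _] := Lp; have [mr' mi' _] := Lq.
apply: (@le_itg _ _ _ (fun x => sqmod R (phi (N x)) * G x + sqmod R (psi (N x)) * G x)).
- apply: kmeasM; last exact: kmeas_gauss.
  under eq_fun do rewrite !cE mulrN opprK.
  by apply: kmeasD; apply: kmeasM.
- move=> x; rewrite normrM (ger0_norm (gauss_ge0 _ _)) -mulrDl.
  apply: ler_wpM2r; first exact: gauss_ge0.
  move: (phi _) (psi _) => [a b] [c d]; rewrite /sqmod /= ler_norml.
  have := sqr_ge0 (a - c); have := sqr_ge0 (b - d).
  have := sqr_ge0 (a + c); have := sqr_ge0 (b + d).
  rewrite !sqrrB !sqrrD; have := sqr_ge0 a; have := sqr_ge0 b.
  have := sqr_ge0 c; have := sqr_ge0 d.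
  by move=> *; apply/andP; split; lra.
- by apply: itgD; exact: L2_itg.
Qed.

Lemma itg_Im_ip phi psi : L2 R n phi -> L2 R n psi ->
  itg n.+1 (fun x => Im (phi (N x) * (psi (N x))^*) * G x).
Proof.
(* Im z = Re (- i z). *)
move=> Lp Lq; have := itg_Re_ip _ _ (L2Z (- ('i)%C) _ Lp) Lq.
congr itg; apply/funext => x; congr (_ * _).
by rewrite !cE /=; ring.
Qed.

Notation Z := (rint R n.+1 G).

Lemma Z_ge0 : 0 <= Z.
Proof. by rewrite rintE; [exact: fint_ge0 (gauss_ge0 _)|exact: gauss_ge0]. Qed.

Lemma ipE phi psi : ip R n phi psi =
  (rint R n.+1 (fun x => Re (phi (N x) * (psi (N x))^*) * G x) / Z) +i*
  (rint R n.+1 (fun x => Im (phi (N x) * (psi (N x))^*) * G x) / Z).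
Proof.
rewrite /ip /sint /cint -fmorphV /=.
set a := rint _ _ _; set b := rint _ _ _; set z := rint _ _ _; set c := rint _ _ _; set d := rint _ _ _.
have -> : a = c by congr rint; apply/funext => x; rewrite !cE /=; ring.
have -> : b = d by congr rint; apply/funext => x; rewrite !cE /=; ring.
by apply: complexP; rewrite !cE /=; ring.
Qed.

Lemma ip_lin (a : C) phi psi chi : L2 R n phi -> L2 R n psi -> L2 R n chi ->
  ip R n (fun x => a * phi x + psi x) chi = a * ip R n phi chi + ip R n psi chi.
Proof.
move=> Lp Lq Lc; rewrite !ipE.
have I1 := itg_Re_ip _ _ Lp Lc; have I2 := itg_Im_ip _ _ Lp Lc.
have I3 := itg_Re_ip _ _ Lq Lc; have I4 := itg_Im_ip _ _ Lq Lc.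
apply: complexP; rewrite !cE /=.
- rewrite (_ : (fun _ => _) = fun x => Re a * (Re (phi (N x) * (chi (N x))^*) * G x) +
    (- Im a * (Im (phi (N x) * (chi (N x))^*) * G x) + Re (psi (N x) * (chi (N x))^*) * G x)).
    rewrite !rintD ?rintZ //; first ring; try exact: itgZ.
    by apply: itgD => //; exact: itgZ.
  by apply/funext => x; rewrite !cE; ring.
- rewrite (_ : (fun _ => _) = fun x => Re a * (Im (phi (N x) * (chi (N x))^*) * G x) +
    (Im a * (Re (phi (N x) * (chi (N x))^*) * G x) + Im (psi (N x) * (chi (N x))^*) * G x)).
    rewrite !rintD ?rintZ //; first ring; try exact: itgZ.
    by apply: itgD => //; exact: itgZ.
  by apply/funext => x; rewrite !cE; ring.
Qed.

Lemma ipJ phi psi : L2 R n phi -> L2 R n psi -> ip R n psi phi = (ip R n phi psi)^*.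
Proof.
move=> Lp Lq; rewrite !ipE /=; apply: complexP => /=.
- by congr (rint _ _ _ / _); apply/funext => x; rewrite !cE; ring.
- rewrite -mulNr -rintN; last exact: itg_Im_ip.
  by congr (rint _ _ _ / _); apply/funext => x; rewrite !cE; ring.
Qed.

Lemma ip_diag_ge0 phi : 0 <= Re (ip R n phi phi).
Proof.
rewrite ipE /= divr_ge0 ?Z_ge0 // rintE; last first.
  move=> x; rewrite mulr_ge0 ?gauss_ge0 // !cE mulrN opprK.
  by rewrite addr_ge0 // -expr2 sqr_ge0.
apply: fint_ge0 => x; rewrite mulr_ge0 ?gauss_ge0 // !cE mulrN opprK.
by rewrite addr_ge0 // -expr2 sqr_ge0.
Qed.

Lemma sqr_l2norm phi : l2norm R n phi ^+ 2 = Re (ip R n phi phi).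
Proof. by rewrite sqr_sqrtr // ip_diag_ge0. Qed.

Lemma l2norm_ge0 phi : 0 <= l2norm R n phi.
Proof. exact: sqrtr_ge0. Qed.

Lemma quadratic_discr (a b c : R) : 0 <= a ->
  (forall t, 0 <= a * t ^+ 2 + 2 * b * t + c) -> b ^+ 2 <= a * c.
Proof.
move=> a0 H; have [a1|a1] := eqVneq a 0.
  have [->|b0] := eqVneq b 0; first by rewrite a1 mul0r expr0n.
  (* With a = 0 and b nonzero, this t gives the value -1. *)
  have := H (- (c + 1) / (2 * b)); rewrite a1 mul0r add0r.
  have -> : 2 * b * (- (c + 1) / (2 * b)) = - (c + 1) by field.
  by move=> h; exfalso; lra.
have ap : 0 < a by rewrite lt_neqAle eq_sym a1.
(* The minimum of the quadratic. *)
have := H (- b / a).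
have -> : a * (- b / a) ^+ 2 + 2 * b * (- b / a) + c = (a * c - b ^+ 2) / a by field.
by rewrite pmulr_lge0 ?invr_gt0 // subr_ge0.
Qed.

(** Cauchy-Schwarz, from the discriminant of the squared norm of t phi + psi as a quadratic in the
    real t. *)
Lemma Re_ip_le phi psi : L2 R n phi -> L2 R n psi ->
  `|Re (ip R n phi psi)| <= l2norm R n phi * l2norm R n psi.
Proof.
move=> Lp Lq; rewrite -ler_sqr ?nnegrE ?mulr_ge0 ?l2norm_ge0 //.
rewrite real_normK ?num_real // exprMn !sqr_l2norm.
apply: quadratic_discr => [|t]; first exact: ip_diag_ge0.
have L : L2 R n (fun x => t%:C * phi x + psi x) by exact: L2_lin.
have := ip_diag_ge0 (fun x => t%:C * phi x + psi x).
rewrite ip_lin // (ipJ _ _ L Lp) (ipJ _ _ L Lq) !ip_lin //.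
rewrite (ipJ _ _ Lp Lq) !cE /= => h.
by apply: le_trans h _; rewrite le_eqVlt; apply/orP; left; apply/eqP; ring.
Qed.

Lemma l2norm_unit (u : C) phi : sqmod R u = 1 -> l2norm R n (fun x => u * phi x) = l2norm R n phi.
Proof.
move=> u1; rewrite /l2norm !ipE /=; congr (Num.sqrt (rint _ _ _ / _)).
apply/funext => x; congr (_ * _); rewrite !cE.
by rewrite -[RHS]mul1r -u1 /sqmod; ring.
Qed.

(** The l^1 norm of C = R^2 is real-valued, treats the two components separately and is
    submultiplicative; using it instead of the modulus costs only constants, such as the 2 in
    [cnorm_ip_le]. *)
Definition cnorm (z : C) : R := `|Re z| + `|Im z|.

Lemma cnorm_ge0 z : 0 <= cnorm z. Proof. exact: addr_ge0. Qed.

Lemma cnormD z w : cnorm (z + w) <= cnorm z + cnorm w.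
Proof.
rewrite /cnorm !cE addrACA; apply: lerD; exact: ler_normD.
Qed.

Lemma cnorm0_eq0 z : cnorm z <= 0 -> z = 0.
Proof.
case: z => a b; rewrite /cnorm /= => h.
have := normr_ge0 a; have := normr_ge0 b => h1 h2.
have /eqP : `|a| = 0 by lra. have /eqP : `|b| = 0 by lra.
by rewrite !normr_eq0 => /eqP -> /eqP ->.
Qed.

Lemma cnormZ (t : R) z : cnorm (t%:C * z) = `|t| * cnorm z.
Proof. by rewrite /cnorm !cE /= !mul0r subr0 addr0 !normrM mulrDr. Qed.

Lemma cnormM z w : cnorm (z * w) <= cnorm z * cnorm w.
Proof.
rewrite /cnorm !cE; apply: le_trans (lerD (ler_normB _ _) (ler_normD _ _)) _.
by rewrite !normrM; lra.
Qed.

Lemma cnorm_ip_le phi psi : L2 R n phi -> L2 R n psi ->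
  cnorm (ip R n phi psi) <= 2 * (l2norm R n phi * l2norm R n psi).
Proof.
move=> Lp Lq; rewrite mulr_natl mulr2n; apply: lerD; first exact: Re_ip_le.
have -> : Im (ip R n phi psi) = Re (ip R n (fun x => - ('i)%C * phi x) psi).
  rewrite !ipE /=; congr (rint _ _ _ / _); apply/funext => x; congr (_ * _).
  by rewrite !cE /=; ring.
rewrite -(l2norm_unit (- ('i)%C) phi); last by rewrite /sqmod /=; ring.
by apply: Re_ip_le => //; exact: L2Z.
Qed.

Lemma l2norm_le phi (B : R) : 0 <= B -> L2 R n phi ->
  (forall x, sqmod R (phi (N x)) <= B ^+ 2) -> l2norm R n phi <= B.
Proof.
move=> B0 Lp hB; rewrite -ler_sqr ?nnegrE ?l2norm_ge0 // sqr_l2norm ipE /=.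
have E x : Re (phi (N x) * (phi (N x))^*) * G x = sqmod R (phi (N x)) * G x.
  by congr (_ * _); rewrite !cE /sqmod; ring.
under eq_fun do rewrite E.
(* Only Z >= 0 is at hand; if Z were 0, the quotient would be 0 and the bound trivial. *)
have [Z0|Z0] := eqVneq Z 0; first by rewrite Z0 invr0 mulr0 sqr_ge0.
rewrite ler_pdivrMr; last by rewrite lt_neqAle eq_sym Z0 Z_ge0.
rewrite -rintZ; last exact: itg_gauss.
rewrite !rintE; last 2 first.
- by move=> x; rewrite mulr_ge0 ?sqr_ge0 ?gauss_ge0.
- by move=> x; rewrite mulr_ge0 ?sqmod_ge0 ?gauss_ge0.
apply: le_fint.
- exact: L2_itg.
- by apply: itgZ; exact: itg_gauss.
- by move=> x; rewrite mulr_ge0 ?sqmod_ge0 ?gauss_ge0.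
- by move=> x; apply: ler_wpM2r => //; exact: gauss_ge0.
Qed.

Lemma l2norm0_ip phi psi : L2 R n phi -> L2 R n psi -> l2norm R n phi = 0 ->
  ip R n phi psi = 0.
Proof.
move=> Lp Lq p0; apply: cnorm0_eq0; apply: le_trans (cnorm_ip_le _ _ Lp Lq) _.
by rewrite p0 mul0r mulr0.
Qed.

Lemma ip_diag0 phi : L2 R n phi -> ip R n phi phi = 0 -> l2norm R n phi = 0.
Proof. by move=> Lp p0; rewrite /l2norm p0 /= sqrtr0. Qed.

End SquareIntegrable.

(** * Orthogonal maps of the sphere as unitary operators *)

Section Rotation.
Context {R : realType} {n : nat}.
Notation C := R[i].
Notation N := (nrm R n.+1).
Implicit Types (phi psi chi : (nat -> R) -> C) (x : nat -> R).
Variable M : 'M[R]_n.+1.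
Hypothesis MM : M^T *m M = 1%:M.

Lemma nrmsq_mxact x : nrmsq R n.+1 (mxact n.+1 M x) = nrmsq R n.+1 x.
Proof.
rewrite /nrmsq; pose v : 'cV[R]_n.+1 := \col_i x i.
have E (w : 'cV[R]_n.+1) : \sum_j w j 0 ^+ 2 = (w^T *m w) 0 0.
  by rewrite mxE; apply: eq_bigr => j _; rewrite mxE expr2.
transitivity (\sum_j (M *m v) j 0 ^+ 2).
  apply: eq_bigr => j _; rewrite mxact_ord mxE; congr (_ ^+ 2).
  by apply: eq_bigr => l _; rewrite mxE.
rewrite E trmx_mul -mulmxA (mulmxA M^T) MM mul1mx -E.
by apply: eq_bigr => j _; rewrite mxE.
Qed.

Lemma nrm_mxact x : N (mxact n.+1 M x) = mxact n.+1 M (N x).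
Proof.
apply/funext => i; rewrite /nrm; case: ifP => ik; last by rewrite mxact_out // leqNgt ik.
rewrite !mxact_lt nrmsq_mxact mulr_suml; apply: eq_bigr => l _.
by rewrite ltn_ord mulrA.
Qed.

Lemma gauss_mxact x : gauss R n.+1 (mxact n.+1 M x) = gauss R n.+1 x.
Proof. by rewrite /gauss nrmsq_mxact. Qed.

Definition rotfun phi : (nat -> R) -> C := fun x => phi (mxact n.+1 M x).

Lemma L2_rot phi : L2 R n phi -> L2 R n (rotfun phi).
Proof.
have rN x : rotfun phi (N x) = phi (N (mxact n.+1 M x)) by rewrite /rotfun nrm_mxact.
move=> [mr mi fin]; split; under eq_fun do rewrite rN.
- exact: (kmeas_mxact n.+1 M (fun x => complex.Re (phi (N x)))).
- exact: (kmeas_mxact n.+1 M (fun x => complex.Im (phi (N x)))).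
- under eq_fun do rewrite -gauss_mxact.
  rewrite (eint_mxact n.+1 M (efin (fun x => sqmod R (phi (N x)) * gauss R n.+1 x))) //.
  + exact: nrmsq_mxact.
  + by move=> x; rewrite lee_fin mulr_ge0 ?sqmod_ge0 ?gauss_ge0.
  + by apply: kmeas_efin; apply: kmeasM; [apply: kmeasD; exact: kmeasX|exact: kmeas_gauss].
Qed.

Lemma ip_rot phi psi : L2 R n phi -> L2 R n psi -> ip R n (rotfun phi) (rotfun psi) = ip R n phi psi.
Proof.
move=> Lp Lq; rewrite !ipE /rotfun; congr ((_ / _) +i* (_ / _)); rewrite -!/(rotfun _ _).
- under eq_fun do rewrite -nrm_mxact -gauss_mxact.
  apply: (rint_mxact n.+1 M (fun x => complex.Re (phi (N x) * (psi (N x))^*) * gauss R n.+1 x)).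
    exact: nrmsq_mxact.
  exact: (itg_Re_ip _ _ Lp Lq).1.
- under eq_fun do rewrite -nrm_mxact -gauss_mxact.
  apply: (rint_mxact n.+1 M (fun x => complex.Im (phi (N x) * (psi (N x))^*) * gauss R n.+1 x)).
    exact: nrmsq_mxact.
  exact: (itg_Im_ip _ _ Lp Lq).1.
Qed.

Lemma l2norm_rot phi : L2 R n phi -> l2norm R n (rotfun phi) = l2norm R n phi.
Proof. by move=> Lp; rewrite /l2norm ip_rot. Qed.

End Rotation.

(** * Equivariance of rho *)

Ltac complex_parts := repeat match goal with
  | |- context [complex.Re (?x + ?y)] => rewrite (cReD x y)
  | |- context [complex.Im (?x + ?y)] => rewrite (cImD x y)
  | |- context [complex.Re (?x * ?y)] => rewrite (cReM x y)
  | |- context [complex.Im (?x * ?y)] => rewrite (cImM x y)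
  | |- context [complex.Re (- ?x)] => rewrite (cReN x)
  | |- context [complex.Im (- ?x)] => rewrite (cImN x)
  | |- context [complex.Re (conjc ?x)] => rewrite (cReJ x)
  | |- context [complex.Im (conjc ?x)] => rewrite (cImJ x)
  end.

Section Equivariance.
Context {R : realType}.
Notation C := R[i].
Notation Re := complex.Re.
Notation Im := complex.Im.

Lemma crd_ord k (z : 'cV[C]_k) (i : 'I_k) : crd R z i.+1 = z i 0.
Proof. by rewrite /crd /= valK. Qed.

(** Indexing entries by natural numbers lets sums over ordinals unfold into expressions that [ring]
    accepts. *)
Definition ent k (A : 'M[C]_k.+1) (i j : nat) : C := A (inord i) (inord j).

Lemma crd_mul k (A : 'M[C]_k.+1) (z : 'cV[C]_k.+1) s : (s < k.+1)%N ->
  crd R (A *m z) s.+1 = \sum_(j < k.+1) ent k A s j * crd R z j.+1.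
Proof.
move=> sk; rewrite -[s]/(nat_of_ord (Ordinal sk)) crd_ord mxE.
apply: eq_bigr => j _; rewrite crd_ord /ent inord_val; congr (A _ _ * _).
by apply: val_inj; rewrite /= inordK.
Qed.

Lemma crd_col_mxu k1 k2 (x : 'cV[C]_k1) (y : 'cV[C]_k2) s : (s < k1)%N ->
  crd R (col_mx x y) s.+1 = crd R x s.+1.
Proof.
move=> sk; have := crd_ord _ (col_mx x y) (lshift k2 (Ordinal sk)).
have := crd_ord _ x (Ordinal sk) => /= -> ->.
by rewrite col_mxEu.
Qed.

Lemma crd_col_mxd k1 k2 (x : 'cV[C]_k1) (y : 'cV[C]_k2) s : (s < k2)%N ->
  crd R (col_mx x y) (k1 + s).+1 = crd R y s.+1.
Proof.
move=> sk; have := crd_ord _ (col_mx x y) (rshift k1 (Ordinal sk)).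
have := crd_ord _ y (Ordinal sk) => /= -> ->.
by rewrite col_mxEd.
Qed.

Lemma entM k (A B : 'M[C]_k.+1) i j :
  ent k (A *m B) i j = \sum_(l < k.+1) ent k A i l * ent k B l j.
Proof. by rewrite /ent mxE; apply: eq_bigr => l _; rewrite inord_val. Qed.

Lemma ent_adj k (A : 'M[C]_k.+1) i j : ent k (adjmx R A) i j = (ent k A j i)^*.
Proof. by rewrite /ent /adjmx !mxE. Qed.

Lemma ent1 k i j : (i < k.+1)%N -> (j < k.+1)%N -> ent k 1%:M i j = (i == j)%:R.
Proof. by move=> ik jk; rewrite /ent mxE -val_eqE /= !inordK. Qed.

Lemma det2_ent (V : 'M[C]_2) :
  \det V = ent 1 V 0 0 * ent 1 V 1 1 - ent 1 V 0 1 * ent 1 V 1 0.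
Proof.
rewrite (expand_det_row _ 0) !big_ord_recl big_ord0 /cofactor !det_mx11 !mxE /= addr0.
rewrite expr0 mul1r expr1 mulN1r mulrN /ent.
by congr (V _ _ * V _ _ - V _ _ * V _ _); apply: val_inj; rewrite /= inordK.
Qed.

(** Two entries of V V^* = 1 together with det V = 1 express the second row through the first; the
    four real parameters form a unit quaternion. *)
Lemma SU2_ent (V : 'M[C]_2) : is_SU R V ->
  exists a b c d : R, [/\ a ^+ 2 + b ^+ 2 + c ^+ 2 + d ^+ 2 = 1,
    ent 1 V 0 0 = a +i* b, ent 1 V 0 1 = c +i* d,
    ent 1 V 1 0 = - c +i* d & ent 1 V 1 1 = a -i* b].
Proof.
move=> [VV]; rewrite det2_ent => dV.
have := congr1 (fun A => ent 1 A 0 0) VV; have := congr1 (fun A => ent 1 A 1 0) VV.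
rewrite /= !entM !big_ord_recl !big_ord0 /= !ent_adj !ent1 //= !addr0 mulr0n mulr1n => e2 e1.
move: dV e1 e2.
set p := ent 1 V 0 0; set q := ent 1 V 0 1; set r := ent 1 V 1 0; set t := ent 1 V 1 1.
move=> dV e1 e2.
have rE : r = - q^*.
  rewrite -[r]mulr1 -e1 (_ : r * _ = p * (r * p^* + t * q^*) - q^* * (p * t - q * r)); last ring.
  by rewrite e2 dV mulr0 mulr1 sub0r.
have tE : t = p^*.
  rewrite -[t]mulr1 -e1 (_ : t * _ = p^* * (p * t - q * r) + q * (r * p^* + t * q^*)); last ring.
  by rewrite e2 dV mulr0 mulr1 addr0.
exists (Re p), (Im p), (Re q), (Im q); split.
- by have := congr1 (@complex.Re R) e1; rewrite !cE /=; lra.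
- by case: (p).
- by case: (q).
- by rewrite rE; case: (q) => x y /=; apply: complexP; complex_parts; rewrite /=; ring.
- by rewrite tE; case: (p).
Qed.

Definition mx_of (n : nat) (s : seq (seq R)) : 'M[R]_n := \matrix_(i < n, j < n) nth 0 (nth [::] s i) j.

(** The components of rho span the quadratic forms in z_1, z_2, and the witness is the rotation of
    R^3 attached to the unit quaternion of g. Its entries have degree 2, so the diagonal of M^T M is
    (a^2 + b^2 + c^2 + d^2)^2. *)
Lemma rho_equivariant22 (g : 'M[C]_2) : is_SU R g -> exists M : 'M[R]_3,
  M^T *m M = 1%:M /\ forall z, rho R C22 (g *m z) = map_mx (real_complex R) M *m rho R C22 z.
Proof.
move=> /SU2_ent[a [b [c [d [s1 e00 e01 e10 e11]]]]].
exists (mx_of 3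
  [:: [:: a^+2 - b^+2 - c^+2 + d^+2; - 2 * (a * b + c * d); - 2 * (a * c - b * d)];
      [:: 2 * (a * b - c * d); a^+2 - b^+2 + c^+2 - d^+2; - 2 * (a * d + b * c)];
      [:: 2 * (a * c + b * d); - 2 * (b * c - a * d); a^+2 + b^+2 - c^+2 - d^+2]]).
split.
  apply/matrixP => i j; rewrite !mxE !big_ord_recl big_ord0 !mxE /=.
  have ss : (a ^+ 2 + b ^+ 2 + c ^+ 2 + d ^+ 2) ^+ 2 = 1 by rewrite s1 expr1n.
  case: i => [[|[|[|i]]] Hi] //; case: j => [[|[|[|j]]] Hj] //=;
    rewrite ?mulr0n ?mulr1n; first [ring | rewrite -[RHS]ss; ring].
have h2 : (2^-1 : C) = (2^-1 : R)%:C by rewrite fmorphV rmorph_nat.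
move=> z; apply/matrixP => i j; rewrite !mxE !big_ord_recl big_ord0 !mxE /=.
have E1 : crd R (g *m z) 1 = (a +i* b) * crd R z 1 + (c +i* d) * crd R z 2.
  by rewrite crd_mul // !big_ord_recl big_ord0 /= e00 e01 addr0.
have E2 : crd R (g *m z) 2 = (- c +i* d) * crd R z 1 + (a -i* b) * crd R z 2.
  by rewrite crd_mul // !big_ord_recl big_ord0 /= e10 e11 addr0.
case: i => [[|[|[|i]]] Hi] //=; rewrite /rho_comp /= E1 E2 h2;
  case: (crd R z 1) => x1 y1; case: (crd R z 2) => x2 y2;
  by apply: complexP; complex_parts; rewrite /=; lra.
Qed.

(** rho is bilinear in (z_1, z_2) and (z_3, z_4), so V and W can be treated one at a time. [MV] and
    [MW] are commuting realizations of unit quaternions by real 4 x 4 matrices, as in left and right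
    multiplication. *)
Lemma rho_equivariant34 (V W : 'M[C]_2) : is_SU R V -> is_SU R W -> exists M : 'M[R]_4,
  M^T *m M = 1%:M /\
  forall z : 'cV[C]_4, rho R C34 ((block_mx V 0 0 W : 'M[C]_(2 + 2)) *m z) = map_mx (real_complex R) M *m rho R C34 z.
Proof.
move=> /SU2_ent[a [b [c [d [s1 e00 e01 e10 e11]]]]].
move=> /SU2_ent[e [f [g [h [s2 f00 f01 f10 f11]]]]].
pose MV := mx_of 4 [:: [:: a; b; d; - c]; [:: - b; a; c; d]; [:: - d; - c; a; - b]; [:: c; - d; b; a]].
pose MW := mx_of 4 [:: [:: e; f; h; g]; [:: - f; e; g; - h]; [:: - h; - g; e; f]; [:: - g; h; - f; e]].
have oV : MV^T *m MV = 1%:M.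
  apply/matrixP => i j; rewrite !mxE !big_ord_recl big_ord0 !mxE /=.
  case: i => [[|[|[|[|i]]]] Hi] //; case: j => [[|[|[|[|j]]]] Hj] //=;
    rewrite ?mulr0n ?mulr1n; first [ring | rewrite -[RHS]s1; ring].
have oW : MW^T *m MW = 1%:M.
  apply/matrixP => i j; rewrite !mxE !big_ord_recl big_ord0 !mxE /=.
  case: i => [[|[|[|[|i]]]] Hi] //; case: j => [[|[|[|[|j]]]] Hj] //=;
    rewrite ?mulr0n ?mulr1n; first [ring | rewrite -[RHS]s2; ring].
exists (MV *m MW); split.
  by rewrite trmx_mul -mulmxA (mulmxA MV^T) oV mul1mx.
have eV (x y : 'cV[C]_2) : rho R C34 (col_mx (V *m x) y : 'cV[C]_(2 + 2)) =
    map_mx (real_complex R) MV *m rho R C34 (col_mx x y : 'cV[C]_(2 + 2)).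
  apply/matrixP => i j; rewrite !mxE !big_ord_recl big_ord0 !mxE /=.
  have E1 : crd R (V *m x) 1 = (a +i* b) * crd R x 1 + (c +i* d) * crd R x 2.
    by rewrite crd_mul // !big_ord_recl big_ord0 /= e00 e01 addr0.
  have E2 : crd R (V *m x) 2 = (- c +i* d) * crd R x 1 + (a -i* b) * crd R x 2.
    by rewrite crd_mul // !big_ord_recl big_ord0 /= e10 e11 addr0.
  have C1 (w : 'cV[C]_2) : crd R (col_mx w y) 1 = crd R w 1 := crd_col_mxu 2 2 w y 0 isT.
  have C2 (w : 'cV[C]_2) : crd R (col_mx w y) 2 = crd R w 2 := crd_col_mxu 2 2 w y 1 isT.
  have C3 (w : 'cV[C]_2) : crd R (col_mx w y) 3 = crd R y 1 := crd_col_mxd 2 2 w y 0 isT.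
  have C4 (w : 'cV[C]_2) : crd R (col_mx w y) 4 = crd R y 2 := crd_col_mxd 2 2 w y 1 isT.
  case: i => [[|[|[|[|i]]]] Hi] //=; rewrite /rho_comp /= ?C1 ?C2 ?C3 ?C4 E1 E2;
    case: (crd R x 1) => x1 y1; case: (crd R x 2) => x2 y2;
    case: (crd R y 1) => x3 y3; case: (crd R y 2) => x4 y4;
    by apply: complexP; complex_parts; rewrite /=; ring.
have eW (x y : 'cV[C]_2) : rho R C34 (col_mx x (W *m y) : 'cV[C]_(2 + 2)) =
    map_mx (real_complex R) MW *m rho R C34 (col_mx x y : 'cV[C]_(2 + 2)).
  apply/matrixP => i j; rewrite !mxE !big_ord_recl big_ord0 !mxE /=.
  have E1 : crd R (W *m y) 1 = (e +i* f) * crd R y 1 + (g +i* h) * crd R y 2.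
    by rewrite crd_mul // !big_ord_recl big_ord0 /= f00 f01 addr0.
  have E2 : crd R (W *m y) 2 = (- g +i* h) * crd R y 1 + (e -i* f) * crd R y 2.
    by rewrite crd_mul // !big_ord_recl big_ord0 /= f10 f11 addr0.
  have C1 (w : 'cV[C]_2) : crd R (col_mx x w) 1 = crd R x 1 := crd_col_mxu 2 2 x w 0 isT.
  have C2 (w : 'cV[C]_2) : crd R (col_mx x w) 2 = crd R x 2 := crd_col_mxu 2 2 x w 1 isT.
  have C3 (w : 'cV[C]_2) : crd R (col_mx x w) 3 = crd R w 1 := crd_col_mxd 2 2 x w 0 isT.
  have C4 (w : 'cV[C]_2) : crd R (col_mx x w) 4 = crd R w 2 := crd_col_mxd 2 2 x w 1 isT.
  case: i => [[|[|[|[|i]]]] Hi] //=; rewrite /rho_comp /= ?C1 ?C2 ?C3 ?C4 E1 E2;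
    case: (crd R x 1) => x1 y1; case: (crd R x 2) => x2 y2;
    case: (crd R y 1) => x3 y3; case: (crd R y 2) => x4 y4;
    by apply: complexP; complex_parts; rewrite /=; ring.
move=> z; rewrite -[z](@vsubmxK _ 2 2) (@mul_block_col _ 2 2) !mul0mx add0r addr0.
by rewrite eV eW map_mxM mulmxA.
Qed.

(** * The case (5,8): the exterior square of C^4 and SU(4) -> SO(6) *)

Definition pfst (I : nat) : nat := nth 0%N [:: 0; 0; 0; 1; 1; 2]%N I.
Definition psnd (I : nat) : nat := nth 0%N [:: 1; 2; 3; 2; 3; 3]%N I.

Definition minor (A : nat -> nat -> C) (i j k l : nat) : C := A i k * A j l - A i l * A j k.

(** The second compound matrix: the action of A on bivectors, in the basis of the e_i wedge e_j with
    i < j. *)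
Definition ext2 (A : nat -> nat -> C) : 'M[C]_6 :=
  \matrix_(I < 6, J < 6) minor A (pfst I) (psnd I) (pfst J) (psnd J).

Definition cmx_of (n : nat) (s : seq (seq C)) : 'M[C]_n := \matrix_(i < n, j < n) nth 0 (nth [::] s i) j.

(** The Gram matrix of the wedge pairing of bivectors, with values in the top exterior power of
    C^4. *)
Definition hodge : 'M[C]_6 := cmx_of 6
  [:: [:: 0; 0; 0; 0; 0; 1]; [:: 0; 0; 0; 0; -1; 0]; [:: 0; 0; 0; 1; 0; 0];
      [:: 0; 0; 1; 0; 0; 0]; [:: 0; -1; 0; 0; 0; 0]; [:: 1; 0; 0; 0; 0; 0]].

(* Let P_ij be the Pluecker coordinates of the pair of vectors (z_1, .., z_4) and
   E (z_5, .., z_8), ordered as 12, 13, 14, 23, 24, 34: then rho (5,8) is the linear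
   image of P by this matrix. *)
Definition plucker_to_rho : 'M[C]_6 := let I := ('i)%C in cmx_of 6
  [:: [:: 0; 0; - I; - I; 0; 0]; [:: 0; 0; 1; -1; 0; 0]; [:: 0; 1; 0; 0; 1; 0];
      [:: 0; I; 0; 0; - I; 0]; [:: - I; 0; 0; 0; 0; - I]; [:: 1; 0; 0; 0; 0; -1]].

(** The Cauchy-Binet formula for 2 x 2 minors. *)
Lemma ext2M (U V : 'M[C]_4) : ext2 (ent 3 (U *m V)) = ext2 (ent 3 U) *m ext2 (ent 3 V).
Proof.
apply/matrixP => I J; rewrite !mxE.
under eq_bigr do rewrite !mxE.
rewrite !big_ord_recl big_ord0 /= /minor !entM !big_ord_recl !big_ord0 /=.
by move: (pfst I) (psnd I) (pfst J) (psnd J) => i j k l; ring.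
Qed.

(** The determinant of the matrix with rows i, j, k, l of A, by Laplace expansion along the two
    pairs of rows. *)
Definition det4 (A : nat -> nat -> C) (i j k l : nat) : C :=
  minor A i j 0 1 * minor A k l 2 3 - minor A i j 0 2 * minor A k l 1 3
  + minor A i j 0 3 * minor A k l 1 2 + minor A i j 1 2 * minor A k l 0 3
  - minor A i j 1 3 * minor A k l 0 2 + minor A i j 2 3 * minor A k l 0 1.

Lemma det_mx33 (A : 'M[C]_3) : \det A =
  A ord0 ord0 * (A (inord 1) (inord 1) * A (inord 2) (inord 2) - A (inord 1) (inord 2) * A (inord 2) (inord 1))
  - A ord0 (inord 1) * (A (inord 1) ord0 * A (inord 2) (inord 2) - A (inord 1) (inord 2) * A (inord 2) ord0)
  + A ord0 (inord 2) * (A (inord 1) ord0 * A (inord 2) (inord 1) - A (inord 1) (inord 1) * A (inord 2) ord0).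
Proof.
pose a (i j : nat) := A (inord i) (inord j).
have AE i j : A i j = a i j by rewrite /a !inord_val.
rewrite (expand_det_row _ ord0) !big_ord_recl big_ord0 /cofactor !det2_ent /ent !mxE !AE /=.
rewrite !inordK //= /bump /=; ring.
Qed.

Lemma det4E (U : 'M[C]_4) : \det U = det4 (ent 3 U) 0 1 2 3.
Proof.
have UE i j : U i j = ent 3 U i j by rewrite /ent !inord_val.
rewrite (expand_det_row _ ord0) !big_ord_recl big_ord0 /cofactor !det_mx33 !mxE !UE /=.
by rewrite !inordK //= /bump /= !(add1n, add0n, addn0) /det4 /minor; ring.
Qed.

Lemma ext2_laplace (A : nat -> nat -> C) (I J : 'I_6) :
  (ext2 A *m hodge *m (ext2 A)^T) I J = det4 A (pfst I) (psnd I) (pfst J) (psnd J).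
Proof.
rewrite mxE; under eq_bigr do rewrite !mxE; rewrite /=.
under eq_bigr do under eq_bigr do rewrite !mxE.
rewrite !big_ord_recl !big_ord0 /= /det4.
move: (pfst I) (psnd I) (pfst J) (psnd J) => i j k l.
by ring.
Qed.

(** A acts on the top exterior power by its determinant. Entrywise, a row common to both pairs gives
    0, and complementary pairs give the determinant up to sign. *)
Lemma ext2_hodge (A : nat -> nat -> C) :
  ext2 A *m hodge *m (ext2 A)^T = det4 A 0 1 2 3 *: hodge.
Proof.
apply/matrixP => I J; rewrite ext2_laplace !mxE /det4 /minor.
by case: I => [[|[|[|[|[|[|I]]]]]] HI] //=; case: J => [[|[|[|[|[|[|J]]]]]] HJ] //=; ring.
Qed.

Lemma ext2_1 : ext2 (ent 3 1%:M) = 1%:M.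
Proof.
apply/matrixP => I J; rewrite !mxE /minor.
case: I => [[|[|[|[|[|[|I]]]]]] HI] //=; case: J => [[|[|[|[|[|[|J]]]]]] HJ] //=;
  by rewrite !ent1 //= ?mulr0n ?mulr1n; ring.
Qed.

Lemma ext2_adj (U : 'M[C]_4) : ext2 (ent 3 (adjmx R U)) = adjmx R (ext2 (ent 3 U)).
Proof.
apply/matrixP => I J; rewrite /adjmx /ext2 !mxE /minor !ent_adj.
move: (pfst I) (psnd I) (pfst J) (psnd J) => i j k l.
by rewrite rmorphB !rmorphM /=; ring.
Qed.

Local Notation T := plucker_to_rho.

Lemma plucker_to_rho_adj : T *m adjmx R T = 2%:M.
Proof.
apply/matrixP => I J; rewrite /adjmx !mxE !big_ord_recl big_ord0 !mxE /=.
case: I => [[|[|[|[|[|[|I]]]]]] HI] //=; case: J => [[|[|[|[|[|[|J]]]]]] HJ] //=;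
  rewrite ?mulr0n ?mulr1n; apply: complexP; complex_parts; rewrite /=; ring.
Qed.

(** Together with [plucker_to_rho_adj]: up to scalars, T is unitary and pulls the standard bilinear
    form of C^6 back to the wedge pairing. *)
Lemma plucker_to_rho_tr : T^T *m T = (-2) *: hodge.
Proof.
apply/matrixP => I J; rewrite !mxE !big_ord_recl big_ord0 !mxE /=.
case: I => [[|[|[|[|[|[|I]]]]]] HI] //=; case: J => [[|[|[|[|[|[|J]]]]]] HJ] //=;
  apply: complexP; complex_parts; rewrite /=; ring.
Qed.

Lemma plucker_to_rho_hodge : T *m hodge *m T^T = (-2)%:M.
Proof.
(* Right multiplication by [hodge] reverses the columns, with a sign in columns 1 and 4; the
   explicit entries keep the remaining sums single. *)
have E : T *m hodge = \matrix_(I < 6, J < 6) (T I (rev_ord J) * (if (J == 1%N :> nat) || (J == 4%N :> nat) then -1 else 1)).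
  apply/matrixP => I J; rewrite !mxE !big_ord_recl big_ord0 !mxE /=.
  case: J => [[|[|[|[|[|[|J]]]]]] HJ] //=; ring.
rewrite E; apply/matrixP => I J; rewrite !mxE !big_ord_recl big_ord0 !mxE /=.
case: I => [[|[|[|[|[|[|I]]]]]] HI] //=; case: J => [[|[|[|[|[|[|J]]]]]] HJ] //=;
  rewrite ?mulr0n ?mulr1n; apply: complexP; complex_parts; rewrite /=; ring.
Qed.

Lemma conj_hodge : map_mx (@conjc R) hodge = hodge.
Proof.
apply/matrixP => I J; rewrite !mxE.
case: I => [[|[|[|[|[|[|I]]]]]] HI] //=; case: J => [[|[|[|[|[|[|J]]]]]] HJ] //=;
  apply: complexP; complex_parts; rewrite /=; ring.
Qed.

Lemma adjmxM k (A B : 'M[C]_k) : adjmx R (A *m B) = adjmx R B *m adjmx R A.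
Proof. by rewrite /adjmx -trmx_mul map_mxM. Qed.

Lemma adjmxZ k (a : C) (A : 'M[C]_k) : adjmx R (a *: A) = a^* *: adjmx R A.
Proof. by apply/matrixP => i j; rewrite !mxE rmorphM. Qed.

Lemma adjmxK k (A : 'M[C]_k) : adjmx R (adjmx R A) = A.
Proof. by apply/matrixP => i j; rewrite !mxE conjcK. Qed.

(** The adjoint and the transpose are both the inverse of M, so M equals its complex conjugate. *)
Lemma unitary_orthogonal_real k (M : 'M[C]_k) :
  M *m adjmx R M = 1%:M -> M *m M^T = 1%:M ->
  exists M' : 'M[R]_k, M'^T *m M' = 1%:M /\ M = map_mx (real_complex R) M'.
Proof.
move=> uM oM; have oM' := mulmx1C oM.
have aE : adjmx R M = M^T by rewrite -[LHS]mul1mx -oM' -mulmxA uM mulmx1.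
have ME : M = map_mx (real_complex R) (map_mx (@complex.Re R) M).
  apply/matrixP => i j; rewrite !mxE.
  have := congr1 (fun A : 'M[C]_k => A j i) aE; rewrite /adjmx !mxE.
  case: (M i j) => x y /= [h]; apply: complexP => //=; lra.
exists (map_mx (@complex.Re R) M); split => //.
have inj : injective (map_mx (real_complex R) : 'M[R]_k -> 'M[C]_k).
  by move=> A B /matrixP h; apply/matrixP => i j; have := h i j; rewrite !mxE => -[].
by apply: inj; rewrite map_mxM -map_trmx -ME oM' map_mx1.
Qed.

Definition plucker (a y : 'cV[C]_4) : 'cV[C]_6 := \col_(I < 6)
  (crd R a (pfst I).+1 * crd R y (psnd I).+1 - crd R a (psnd I).+1 * crd R y (pfst I).+1).

Lemma pfst_lt I : (pfst I < 4)%N.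
Proof. by case: I => [|[|[|[|[|[|[|]]]]]]]. Qed.

Lemma psnd_lt I : (psnd I < 4)%N.
Proof. by case: I => [|[|[|[|[|[|[|]]]]]]]. Qed.

Lemma plucker_mul (U : 'M[C]_4) a y :
  plucker (U *m a) (U *m y) = ext2 (ent 3 U) *m plucker a y.
Proof.
apply/matrixP => I j; rewrite !mxE; under eq_bigr do rewrite !mxE.
rewrite !crd_mul ?pfst_lt ?psnd_lt // !big_ord_recl !big_ord0 /= /minor.
by move: (pfst I) (psnd I) => i k; ring.
Qed.

Lemma Emx_invol : Emx R *m Emx R = 1%:M.
Proof.
apply/matrixP => i j; rewrite !mxE !big_ord_recl big_ord0 !mxE /=.
by case: i => [[|[|[|[|i]]]] Hi] //; case: j => [[|[|[|[|j]]]] Hj] //=;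
  rewrite ?mulr0n ?mulr1n; ring.
Qed.

(** E is an involution, so L(g) turns the pair (a, E b) into (U a, U E b): both vectors move by the
    same U, which makes their Pluecker coordinates equivariant. *)
Lemma rho58E (a b : 'cV[C]_4) :
  rho R C58 (col_mx a b : 'cV[C]_(4 + 4)) = T *m plucker a (Emx R *m b).
Proof.
have C1 : crd R (col_mx a b) 1 = crd R a 1 := crd_col_mxu 4 4 a b 0 isT.
have C2 : crd R (col_mx a b) 2 = crd R a 2 := crd_col_mxu 4 4 a b 1 isT.
have C3 : crd R (col_mx a b) 3 = crd R a 3 := crd_col_mxu 4 4 a b 2 isT.
have C4 : crd R (col_mx a b) 4 = crd R a 4 := crd_col_mxu 4 4 a b 3 isT.
have C5 : crd R (col_mx a b) 5 = crd R b 1 := crd_col_mxd 4 4 a b 0 isT.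
have C6 : crd R (col_mx a b) 6 = crd R b 2 := crd_col_mxd 4 4 a b 1 isT.
have C7 : crd R (col_mx a b) 7 = crd R b 3 := crd_col_mxd 4 4 a b 2 isT.
have C8 : crd R (col_mx a b) 8 = crd R b 4 := crd_col_mxd 4 4 a b 3 isT.
have entE i j : (i < 4)%N -> (j < 4)%N -> ent 3 (Emx R) i j = Eent R i j.
  by move=> i4 j4; rewrite /ent mxE !inordK.
have Y i : (i < 4)%N -> crd R (Emx R *m b) i.+1 =
    Eent R i 0 * crd R b 1 + Eent R i 1 * crd R b 2 + Eent R i 2 * crd R b 3 + Eent R i 3 * crd R b 4.
  by move=> i4; rewrite crd_mul // !big_ord_recl big_ord0 /= !entE //; ring.
apply/matrixP => i j; rewrite !mxE !big_ord_recl big_ord0 !mxE /=.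
rewrite (Y 0%N) // (Y 1%N) // (Y 2%N) // (Y 3%N) //.
by case: i => [[|[|[|[|[|[|i]]]]]] Hi] //=;
  rewrite /rho_comp ?C1 ?C2 ?C3 ?C4 ?C5 ?C6 ?C7 ?C8 /=; ring.
Qed.

(** Half of T m T^* is unitary because U is, and complex orthogonal because m preserves the wedge
    pairing when det U = 1. Being both, it is real. *)
Lemma rho_equivariant58 (U : 'M[C]_4) : is_SU R U -> exists M : 'M[R]_6,
  M^T *m M = 1%:M /\
  forall z : 'cV[C]_8, rho R C58 ((block_mx U 0 0 (Emx R *m U *m Emx R) : 'M[C]_(4 + 4)) *m z)
    = map_mx (real_complex R) M *m rho R C58 z.
Proof.
move=> [UU dU]; pose m := ext2 (ent 3 U).
have mm : m *m adjmx R m = 1%:M by rewrite -ext2_adj -ext2M UU ext2_1.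
have mh : m *m hodge *m m^T = hodge by rewrite ext2_hodge -det4E dU scale1r.
have h2 : 2^-1 * 2 = 1 :> C by rewrite mulVf // pnatr_eq0.
have TT' : adjmx R T *m T = 2%:M.
  have : (2^-1 *: T) *m adjmx R T = 1%:M.
    by rewrite -scalemxAl plucker_to_rho_adj scale_scalar_mx h2.
  move=> /mulmx1C; rewrite -scalemxAr => h.
  by have := congr1 (fun A => 2 *: A) h; rewrite /= scalerA mulrC h2 scale1r scalemx1.
pose M := 2^-1 *: (T *m m *m adjmx R T).
have c2 : (2^-1 : C)^* = 2^-1 by rewrite fmorphV rmorph_nat.
have aM : adjmx R M = 2^-1 *: (T *m (adjmx R m *m adjmx R T)).
  by rewrite /M adjmxZ !adjmxM adjmxK; congr (_ *: _); exact: c2.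
have uM : M *m adjmx R M = 1%:M.
  rewrite aM /M -scalemxAl -scalemxAr scalerA.
  rewrite -(mulmxA (T *m m)) (mulmxA (adjmx R T)) TT' mul_scalar_mx -scalemxAr.
  rewrite mulmxA -(mulmxA T) mm mulmx1 plucker_to_rho_adj scale_scalar_mx scale_scalar_mx.
  by congr (_%:M); field.
have oM : M *m M^T = 1%:M.
  have aT : adjmx R T *m (adjmx R T)^T = (-2) *: hodge.
    rewrite /adjmx trmxK map_trmx -map_mxM plucker_to_rho_tr map_mxZ conj_hodge.
    by rewrite rmorphN rmorph_nat.
  rewrite /M linearZ /= -scalemxAl -scalemxAr scalerA !trmx_mul.
  rewrite -(mulmxA (T *m m)) (mulmxA (adjmx R T)) aT -scalemxAl -scalemxAr scalerA.
  rewrite !mulmxA -2!(mulmxA T) mh plucker_to_rho_hodge scale_scalar_mx.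
  by congr (_%:M); field.
have [M' [oM' ME]] := unitary_orthogonal_real _ _ uM oM.
exists M'; split => // z; rewrite -ME.
rewrite -[z](@vsubmxK _ 4 4) (@mul_block_col _ 4 4) !mul0mx add0r addr0 !rho58E.
rewrite -!mulmxA (mulmxA (Emx R)) Emx_invol mul1mx plucker_mul /M -scalemxAl -!mulmxA.
by rewrite (mulmxA (adjmx R T)) TT' mul_scalar_mx -!scalemxAr scalerA h2 scale1r.
Qed.

Lemma rho_equivariant c (g : Fgrp R c) : in_F R c g -> exists M : 'M[R]_((ndim c).+1),
  M^T *m M = 1%:M /\
  forall z, rho R c (Lact R c g z) = map_mx (real_complex R) M *m rho R c z.
Proof.
case: c g => g /=.
- exact: rho_equivariant22.
- by move=> [h1 h2]; exact: rho_equivariant34.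
- exact: rho_equivariant58.
Qed.

Lemma is_SU_unitary k (U : 'M[C]_k) : is_SU R U -> adjmx R U *m U = 1%:M.
Proof. by case=> /mulmx1C. Qed.

(** Serves the Gaussian measure on C^m, as [rho_equivariant] serves the sphere. *)
Lemma Lmat_unitary c (g : Fgrp R c) : in_F R c g -> adjmx R (Lmat R c g) *m Lmat R c g = 1%:M.
Proof.
have adj_block k1 k2 (A : 'M[C]_k1) (B : 'M[C]_k2) :
    adjmx R (block_mx A 0 0 B) = block_mx (adjmx R A) 0 0 (adjmx R B).
  by rewrite /adjmx map_block_mx tr_block_mx !map_mx0 !trmx0.
have blockU k1 k2 (A : 'M[C]_k1) (B : 'M[C]_k2) : adjmx R A *m A = 1%:M ->
    adjmx R B *m B = 1%:M -> adjmx R (block_mx A 0 0 B) *m block_mx A 0 0 B = 1%:M.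
  move=> uA uB; rewrite adj_block mulmx_block !mulmx0 !mul0mx !addr0 !add0r uA uB.
  by rewrite -scalar_mx_block.
have EE : adjmx R (Emx R) = Emx R.
  apply/matrixP => i j; rewrite !mxE.
  case: i => [[|[|[|[|i]]]] Hi] //; case: j => [[|[|[|[|j]]]] Hj] //=;
  apply: complexP; complex_parts; rewrite /=; ring.
case: c g => g /=; first exact: is_SU_unitary.
- by move=> [/is_SU_unitary u1 /is_SU_unitary u2]; exact: (blockU 2 2).
- move=> /is_SU_unitary u1; apply: (blockU 4 4) => //.
  rewrite !adjmxM EE -!mulmxA (mulmxA (Emx R) (Emx R)) Emx_invol mul1mx.
  by rewrite (mulmxA (adjmx R g)) u1 mul1mx Emx_invol.
Qed.

End Equivariance.

(** * Coherent states *)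

Section RealSeries.
Context {R : realType}.

Definition exp_tail (y : R) (m : nat) : R := expR y - series (exp_coeff y) m.

Lemma exp_coeff_nneg (y : R) l : 0 <= y -> 0 <= exp_coeff y l.
Proof. by move=> y0; rewrite /exp_coeff /= divr_ge0 ?exprn_ge0. Qed.

Lemma series_exp_coeff_mono (y : R) : 0 <= y ->
  {homo series (exp_coeff y) : p q / (p <= q)%N >-> p <= q}.
Proof.
move=> y0 p q pq; apply: (nondecreasing_series (P := xpredT)) => // l _ _.
exact: exp_coeff_nneg.
Qed.

Lemma series_exp_coeff_le (y : R) m : 0 <= y -> series (exp_coeff y) m <= expR y.
Proof.
move=> y0; apply: nondecreasing_cvgn_le; first exact: series_exp_coeff_mono.
exact: is_cvg_series_exp_coeff.
Qed.

Lemma exp_tail_ge0 (y : R) m : 0 <= y -> 0 <= exp_tail y m.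
Proof. by move=> y0; rewrite subr_ge0 series_exp_coeff_le. Qed.

Lemma exp_tail_cvg0 (y : R) : exp_tail y @ \oo --> 0.
Proof.
rewrite -(subrr (expR y)); apply: cvgB; first exact: cvg_cst.
exact: is_cvg_series_exp_coeff.
Qed.

Lemma exp_tail_le (y b : R) m :
  (forall k, (m <= k)%N -> \sum_(m <= l < k) exp_coeff y l <= b) -> exp_tail y m <= b.
Proof.
move=> hb; rewrite /exp_tail lerBlDr; apply: limr_le; first exact: is_cvg_series_exp_coeff.
exists m => // k /= mk; rewrite -lerBlDr sub_series_geq //; exact: hb.
Qed.

Lemma exp_tail_sum (y : R) m k : 0 <= y -> (m <= k)%N ->
  \sum_(m <= l < k) exp_coeff y l <= exp_tail y m.
Proof.
by move=> y0 mk; rewrite -sub_series_geq // lerD2r series_exp_coeff_le.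
Qed.

(** The tail starts in degree m, so it vanishes to order m in s. This order is what isolates a
    homogeneous component in [Sblk_diag]. *)
Lemma exp_tail_scale (s y : R) m : 0 <= s <= 1 -> 0 <= y ->
  exp_tail (s * y) m <= s ^+ m * exp_tail y m.
Proof.
move=> /andP[s0 s1] y0; apply: exp_tail_le => k mk.
apply: le_trans (ler_wpM2l (exprn_ge0 m s0) (exp_tail_sum _ _ _ y0 mk)).
rewrite mulr_sumr; apply: ler_sum_nat => l /andP[ml _].
rewrite /exp_coeff /= exprMn -mulrA; apply: ler_wpM2r.
  by rewrite divr_ge0 ?exprn_ge0.
exact: ler_wiXn2l.
Qed.

Lemma series_tail (v : nat -> R) (y : R) : 0 <= y -> (forall l, `|v l| <= exp_coeff y l) ->
  forall m, `|limn (series v) - series v m| <= exp_tail y m.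
Proof.
move=> y0 hv m.
have cv : cvgn (series v).
  apply: normed_cvg; apply: series_le_cvg (is_cvg_series_exp_coeff y) => l //.
  - exact: normr_ge0.
  - exact: exp_coeff_nneg.
  - exact: hv.
have cc : cvgn (fun _ : nat => series v m) by exact: is_cvg_cst.
have -> : limn (series v) - series v m = limn (series v - (fun=> series v m)).
  by rewrite limB // lim_cst.
rewrite -lim_norm; last exact: is_cvgB.
apply: limr_le.
  by apply: is_cvg_norm; exact: is_cvgB.
exists m => // k /= mk; rewrite [X in `|X|](_ : _ = series v k - series v m) // sub_series_geq //.
apply: le_trans (ler_norm_sum _ _ _) _.
apply: le_trans (exp_tail_sum _ _ _ y0 mk).
by apply: ler_sum_nat => l _; exact: hv.
Qed.

End RealSeries.

(** * Truncated coherent states, uniform bounds on the sphere and measurability *)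

Section CoherentStates.
Context {R : realType} {n : nat}.
Notation C := R[i].
Notation Re := complex.Re.
Notation Im := complex.Im.
Notation N := (nrm R n.+1).
Variable hbar : R.
Implicit Types (a : 'cV[C]_n.+1) (x : nat -> R).

Definition eterm a (l : nat) : (nat -> R) -> C :=
  fun x => (ccoef R n l)%:C * (dotx R x a / hbar%:C) ^+ l.

Definition Phi_trunc a (m : nat) : (nat -> R) -> C := fun x => \sum_(l < m) eterm a l x.

Lemma Re_sum (I : Type) (s : seq I) (F : I -> C) : Re (\sum_(i <- s) F i) = \sum_(i <- s) Re (F i).
Proof. by elim: s => [|i s IH]; rewrite ?big_nil // !big_cons cReD IH. Qed.

Lemma Im_sum (I : Type) (s : seq I) (F : I -> C) : Im (\sum_(i <- s) F i) = \sum_(i <- s) Im (F i).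
Proof. by elim: s => [|i s IH]; rewrite ?big_nil // !big_cons cImD IH. Qed.

Lemma csum_tail (u : nat -> C) (y : R) : 0 <= y -> (forall l, cnorm (u l) <= exp_coeff y l) ->
  forall m, cnorm (csum R u - \sum_(l < m) u l) <= 2 * exp_tail y m.
Proof.
move=> y0 hu m; rewrite /cnorm cReD cImD cReN cImN Re_sum Im_sum /csum /=.
rewrite mulr_natl mulr2n; apply: lerD.
- rewrite -(big_mkord xpredT (fun l => Re (u l))).
  apply: (series_tail (fun l => Re (u l))) => // l.
  by apply: le_trans (hu l); rewrite lerDl.
- rewrite -(big_mkord xpredT (fun l => Im (u l))).
  apply: (series_tail (fun l => Im (u l))) => // l.
  by apply: le_trans (hu l); rewrite lerDr.
Qed.

Lemma cnorm_sum (I : Type) (s : seq I) (F : I -> C) :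
  cnorm (\sum_(i <- s) F i) <= \sum_(i <- s) cnorm (F i).
Proof.
elim: s => [|i s IH]; first by rewrite !big_nil /cnorm /= normr0 addr0.
by rewrite !big_cons; apply: le_trans (cnormD _ _) _; rewrite lerD2l.
Qed.

Lemma cnormX (z : C) l : cnorm (z ^+ l) <= cnorm z ^+ l.
Proof.
elim: l => [|l IH]; first by rewrite !expr0 /cnorm /= normr1 normr0 addr0.
by rewrite !exprS; apply: le_trans (cnormM _ _) _; apply: ler_wpM2l => //; exact: cnorm_ge0.
Qed.

Lemma cnormJ (z : C) : cnorm z^* = cnorm z.
Proof. by case: z => u v; rewrite /cnorm /= normrN. Qed.

Lemma nrm_le1 x s : `|N x s| <= 1.
Proof.
rewrite /nrm; case: ifP => sk; last by rewrite normr0.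
have h : x s ^+ 2 <= nrmsq R n.+1 x.
  rewrite /nrmsq (bigD1 (Ordinal sk)) //= lerDl.
  by apply: sumr_ge0 => j _; exact: sqr_ge0.
have h2 : `|x s| <= Num.sqrt (nrmsq R n.+1 x).
  by rewrite -sqrtr_sqr ler_sqrt // nrmsq_ge0.
rewrite normrM normfV (ger0_norm (sqrtr_ge0 _)).
have [->|q0] := eqVneq (Num.sqrt (nrmsq R n.+1 x)) 0; first by rewrite invr0 mulr0.
by rewrite ler_pdivrMr ?mul1r // lt_neqAle eq_sym q0 sqrtr_ge0.
Qed.

(* The factor 3 absorbs the square roots: sqrt (2 l + n - 1) <= 3 ^ l * sqrt (n - 1). *)
Definition growth a : R := 3 * (\sum_(s < n.+1) cnorm (a s 0) * `|hbar^-1|).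

Lemma growth_ge0 a : 0 <= growth a.
Proof.
by rewrite mulr_ge0 // sumr_ge0 // => s _; rewrite mulr_ge0 ?cnorm_ge0.
Qed.

Lemma growthZ (s : R) a : 0 <= s -> growth (s%:C *: a) = s * growth a.
Proof.
move=> s0; rewrite /growth mulrCA; congr (_ * _); rewrite mulr_sumr.
by apply: eq_bigr => i _; rewrite mxE cnormZ ger0_norm // mulrA.
Qed.

Lemma cnorm_dotx a x : cnorm (dotx R (N x) a / hbar%:C) <= growth a / 3.
Proof.
rewrite /growth mulrAC divff ?pnatr_eq0 // mul1r -mulr_suml -fmorphV mulrC /= cnormZ mulrC.
apply: ler_wpM2r => //; apply: le_trans (cnorm_sum _ _ _) _.
apply: ler_sum => s _; rewrite cnormZ cnormJ -[leRHS]mul1r.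
by apply: ler_wpM2r; [exact: cnorm_ge0|exact: nrm_le1].
Qed.

Lemma ccoef_ge0 l : 0 <= ccoef R n l.
Proof. by rewrite divr_ge0 ?sqrtr_ge0 // mulr_ge0 // sqrtr_ge0. Qed.

Lemma ccoef_le l : ccoef R n l <= 3 ^+ l / l`!%:R.
Proof.
rewrite /ccoef invfM mulrA mulrAC; apply: ler_wpM2r; first by rewrite invr_ge0.
have [k0|k0] := eqVneq (n - 1)%N 0%N.
  by rewrite k0 sqrtr0 invr0 mulr0 exprn_ge0.
have kp : 0 < Num.sqrt (n - 1)%:R :> R by rewrite sqrtr_gt0 ltr0n lt0n.
rewrite ler_pdivrMr // -[3 ^+ l]ger0_norm ?exprn_ge0 // -sqrtr_sqr -sqrtrM ?sqr_ge0 //.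
rewrite ler_sqrt ?mulr_ge0 ?sqr_ge0 // -!natrX -natrM ler_nat.
have h3 : (2 * l + 1 <= 3 ^ l)%N.
  by elim: l => [//|l IH]; rewrite expnS; lia.
have h9 : (3 ^ l <= (3 ^ l) ^ 2)%N by rewrite -{1}[(3 ^ l)%N]expn1 leq_pexp2l // expn_gt0.
have : ((2 * l + 1) * (n - 1) <= (3 ^ l) ^ 2 * (n - 1))%N.
  by rewrite leq_mul2r (leq_trans h3 h9) orbT.
by apply: leq_trans; nia.
Qed.

Lemma eterm_le a l x : cnorm (eterm a l (N x)) <= exp_coeff (growth a) l.
Proof.
rewrite /eterm cnormZ ger0_norm ?ccoef_ge0 //.
apply: le_trans (ler_wpM2l (ccoef_ge0 l) (cnormX _ _)) _.
apply: le_trans (ler_wpM2r _ (ccoef_le l)) _; first by rewrite exprn_ge0 ?cnorm_ge0.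
rewrite /exp_coeff /= mulrAC; apply: ler_wpM2r; first by rewrite invr_ge0.
rewrite -exprMn; apply: lerXn2r; rewrite ?nnegrE ?growth_ge0 ?mulr_ge0 ?cnorm_ge0 //.
by rewrite mulrC -ler_pdivlMr // cnorm_dotx.
Qed.

Lemma Phi_tail a m x :
  cnorm (Phi R hbar a (N x) - Phi_trunc a m (N x)) <= 2 * exp_tail (growth a) m.
Proof.
by apply: csum_tail => [|l]; [exact: growth_ge0|exact: eterm_le].
Qed.

Lemma Phi_trunc_le a m x : cnorm (Phi_trunc a m (N x)) <= expR (growth a).
Proof.
apply: le_trans (cnorm_sum _ _ _) _.
apply: le_trans (series_exp_coeff_le _ m (growth_ge0 a)).
rewrite /series /= big_mkord; apply: ler_sum => l _; exact: eterm_le.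
Qed.

Lemma Phi_le a x : cnorm (Phi R hbar a (N x)) <= 2 * expR (growth a).
Proof.
have := Phi_tail a 0 x.
by rewrite /Phi_trunc big_ord0 subr0 /exp_tail /series /= big_geq // subr0.
Qed.

Definition cmeas k (F : (nat -> R) -> C) :=
  kmeas R k (fun x => Re (F x)) /\ kmeas R k (fun x => Im (F x)).

Lemma cmeas_cst k (c : C) : cmeas k (fun=> c).
Proof. by split; exact: kmeas_cst. Qed.

Lemma cmeasD k F G : cmeas k F -> cmeas k G -> cmeas k (fun x => F x + G x).
Proof.
move=> [f1 f2] [g1 g2]; split.
- by under eq_fun do rewrite cReD; exact: kmeasD.
- by under eq_fun do rewrite cImD; exact: kmeasD.
Qed.

Lemma cmeasN k F : cmeas k F -> cmeas k (fun x => - F x).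
Proof.
move=> [f1 f2]; split.
- by under eq_fun do rewrite cReN; exact: kmeasN.
- by under eq_fun do rewrite cImN; exact: kmeasN.
Qed.

Lemma cmeasJ k F : cmeas k F -> cmeas k (fun x => (F x)^*).
Proof.
move=> [f1 f2]; split.
- by under eq_fun do rewrite cReJ.
- by under eq_fun do rewrite cImJ; exact: kmeasN.
Qed.

Lemma cmeasM k F G : cmeas k F -> cmeas k G -> cmeas k (fun x => F x * G x).
Proof.
move=> [f1 f2] [g1 g2]; split.
- by under eq_fun do rewrite cReM; apply: kmeasB; exact: kmeasM.
- by under eq_fun do rewrite cImM; apply: kmeasD; exact: kmeasM.
Qed.

Lemma cmeas_real k f : kmeas R k f -> cmeas k (fun x => (f x)%:C).
Proof. by move=> mf; split => //; exact: kmeas_cst. Qed.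

(** Dividing the conjugate by the squared modulus reduces this to the inverse of a nonnegative real
    function; at zeros of F both expressions are 0. *)
Lemma cmeasV k F : cmeas k F -> cmeas k (fun x => (F x)^-1).
Proof.
move=> mF; have [f1 f2] := mF.
have -> : (fun x => (F x)^-1) = (fun x => ((sqmod R (F x))^-1)%:C * (F x)^*).
  apply/funext => x; case: (F x) => p q; rewrite /sqmod /=.
  have -> : (p +i* q)^-1 = (p / (p ^+ 2 + q ^+ 2)) +i* - (q / (p ^+ 2 + q ^+ 2)) by [].
  by apply: complexP; rewrite !cE /=; ring.
apply: cmeasM; last exact: cmeasJ.
apply: cmeas_real; apply: (kmeas_inv k (fun x => sqmod R (F x))) => [x|]; first exact: sqmod_ge0.
by apply: kmeasD; exact: kmeasX.
Qed.

Lemma cmeasX k F l : cmeas k F -> cmeas k (fun x => F x ^+ l).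
Proof.
move=> mF; elim: l => [|l IH]; first exact: cmeas_cst.
by under eq_fun do rewrite exprS; exact: cmeasM.
Qed.

Lemma cmeas_sum k (I : Type) (s : seq I) (F : I -> (nat -> R) -> C) :
  (forall i, cmeas k (F i)) -> cmeas k (fun x => \sum_(i <- s) F i x).
Proof.
move=> mF; elim: s => [|i s IH].
  by under eq_fun do rewrite big_nil; exact: cmeas_cst.
by under eq_fun do rewrite big_cons; exact: cmeasD.
Qed.

Lemma cmeas_prod k (I : Type) (s : seq I) (F : I -> (nat -> R) -> C) :
  (forall i, cmeas k (F i)) -> cmeas k (fun x => \prod_(i <- s) F i x).
Proof.
move=> mF; elim: s => [|i s IH].
  by under eq_fun do rewrite big_nil; exact: cmeas_cst.
by under eq_fun do rewrite big_cons; exact: cmeasM.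
Qed.

Lemma cmeas_cvg k (h : nat -> (nat -> R) -> C) F (b : (nat -> R) -> nat -> R) :
  (forall m, cmeas k (h m)) -> (forall x m, cnorm (F x - h m x) <= b x m) ->
  (forall x, b x @ \oo --> 0) -> cmeas k F.
Proof.
move=> mh hb b0.
have key (f g : nat -> R) (l : R) : (forall m, `|l - f m| <= g m) -> g @ \oo --> 0 -> f @ \oo --> l.
  move=> h1 h2; apply/cvgrPdist_le => e e0.
  have /cvgrPdist_le /(_ e e0) := h2; apply: filterS => m; rewrite sub0r normrN.
  by move=> h3; apply: le_trans (h1 m) _; apply: le_trans h3; exact: ler_norm.
split.
- apply: (kmeas_cvg k (fun m x => Re (h m x))) => [m|x]; first exact: (mh m).1.
  apply: (key _ (b x)) => // m; apply: le_trans (hb x m).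
  by rewrite /cnorm cReD cReN lerDl.
- apply: (kmeas_cvg k (fun m x => Im (h m x))) => [m|x]; first exact: (mh m).2.
  apply: (key _ (b x)) => // m; apply: le_trans (hb x m).
  by rewrite /cnorm cImD cImN lerDr.
Qed.

Lemma sqmod_cnorm (z : C) : sqmod R z <= cnorm z ^+ 2.
Proof.
rewrite /sqmod /cnorm sqrrD -!normrX !(ger0_norm (sqr_ge0 _)).
by rewrite addrAC lerDl mulrn_wge0 // mulr_ge0.
Qed.

Lemma L2_cmeas phi (B : R) : cmeas n.+1 (fun x => phi (N x)) ->
  (forall x, cnorm (phi (N x)) <= B) -> L2 R n phi.
Proof.
move=> [m1 m2] hB; apply: (@L2_bounded _ _ _ (B ^+ 2)) => // x.
apply: le_trans (sqmod_cnorm _) _; apply: lerXn2r (hB x); rewrite nnegrE ?cnorm_ge0 //.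
by apply: le_trans (hB x); exact: cnorm_ge0.
Qed.

Lemma l2norm_cnorm phi (B : R) : L2 R n phi ->
  (forall x, cnorm (phi (N x)) <= B) -> l2norm R n phi <= B.
Proof.
move=> Lp hB; have B0 : 0 <= B by apply: le_trans (hB (fun=> 0)); exact: cnorm_ge0.
apply: l2norm_le => // x; apply: le_trans (sqmod_cnorm _) _.
by apply: lerXn2r (hB x); rewrite nnegrE ?cnorm_ge0.
Qed.

(** Expanding (x . a)^l over all maps f separates x from a: in its first argument, a form evaluated
    at [eterm] becomes a polynomial in the conjugates of the entries of a. *)
Definition monomial l (f : {ffun 'I_l -> 'I_n.+1}) : (nat -> R) -> C :=
  fun x => (\prod_(i < l) x (f i))%:C.

Lemma L2_monomial l (f : {ffun 'I_l -> 'I_n.+1}) : L2 R n (monomial l f).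
Proof.
apply: (L2_cmeas _ 1) => [|x].
  rewrite /monomial; under eq_fun do rewrite rmorph_prod.
  by apply: cmeas_prod => i; apply: cmeas_real; exact: kmeas_nrm.
rewrite /monomial /cnorm /= normr0 addr0 normr_prod.
by apply: prodr_ile1 => i; rewrite normr_ge0 nrm_le1.
Qed.

Definition mcoef l a (f : {ffun 'I_l -> 'I_n.+1}) : C :=
  (ccoef R n l)%:C * (hbar%:C)^-1 ^+ l * \prod_(i < l) (a (f i) 0)^*.

Lemma eterm_monomial a l x :
  eterm a l x = \sum_(f : {ffun 'I_l -> 'I_n.+1}) mcoef l a f * monomial l f x.
Proof.
rewrite /eterm exprMn mulrA mulrAC.
have -> : dotx R x a ^+ l = \sum_(f : {ffun 'I_l -> 'I_n.+1}) \prod_(i < l) ((x (f i))%:C * (a (f i) 0)^*).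
  rewrite -(bigA_distr_bigA (fun (i : 'I_l) (s : 'I_n.+1) => (x s)%:C * (a s 0)^*)).
  by rewrite prodr_const card_ord.
rewrite mulr_sumr; apply: eq_bigr => f _.
by rewrite big_split /= /mcoef /monomial rmorph_prod; ring.
Qed.

Lemma L2_eterm a l : L2 R n (eterm a l).
Proof.
have -> : eterm a l = fun x => \sum_(f : {ffun 'I_l -> 'I_n.+1}) mcoef l a f * monomial l f x.
  by apply/funext => x; exact: eterm_monomial.
by apply: L2_sum => f; apply: L2Z; exact: L2_monomial.
Qed.

Lemma L2_Phi_trunc a m : L2 R n (Phi_trunc a m).
Proof. by apply: L2_sum => l; exact: L2_eterm. Qed.

Lemma L2_Phi a : L2 R n (Phi R hbar a).
Proof.
apply: (L2_cmeas _ (2 * expR (growth a))) => [|x]; last exact: Phi_le.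
apply: (cmeas_cvg n.+1 (fun m x => Phi_trunc a m (N x)) _ (fun _ m => 2 * exp_tail (growth a) m)).
- by move=> m; have [] := L2_Phi_trunc a m.
- by move=> x m; exact: Phi_tail.
- by move=> _; rewrite -(mulr0 2); apply: cvgMr; exact: exp_tail_cvg0.
Qed.

Lemma l2norm_Phi_tail a m :
  l2norm R n (fun x => Phi R hbar a x - Phi_trunc a m x) <= 2 * exp_tail (growth a) m.
Proof.
apply: l2norm_cnorm => [|x]; last exact: Phi_tail.
by apply: L2B; [exact: L2_Phi|exact: L2_Phi_trunc].
Qed.

Lemma l2norm_Phi a : l2norm R n (Phi R hbar a) <= 2 * expR (growth a).
Proof. by apply: l2norm_cnorm => [|x]; [exact: L2_Phi|exact: Phi_le]. Qed.

Lemma l2norm_Phi_trunc a m : l2norm R n (Phi_trunc a m) <= 2 * expR (growth a).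
Proof.
apply: l2norm_cnorm => [|x]; first exact: L2_Phi_trunc.
apply: le_trans (Phi_trunc_le _ _ _) _.
by rewrite mulr_natl mulr2n lerDl expR_ge0.
Qed.

Lemma eterm_scale (s : R) a l x : eterm (s%:C *: a) l x = (s ^+ l)%:C * eterm a l x.
Proof.
rewrite /eterm rmorphXn mulrCA -exprMn; congr (_ * _ ^+ _).
rewrite mulrA; congr (_ / _); rewrite /dotx mulr_sumr; apply: eq_bigr => i _.
rewrite mxE; apply: complexP; rewrite !cE /=; ring.
Qed.

End CoherentStates.

(** * Sesquilinear forms on coherent states *)

Section ComplexPolynomials.
Context {R : realType}.
Notation C := R[i].

Lemma poly_real_eq0 (p : {poly C}) : (forall x : R, p.[x%:C] = 0) -> p = 0.
Proof.
move=> p0; apply: (@roots_geq_poly_eq0 _ _ [seq (k%:R : R)%:C | k <- iota 0 (size p)]).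
- by apply/allP => _ /mapP[k _ ->]; apply/rootP.
- rewrite map_inj_uniq ?iota_uniq // => i j /(congr1 (@complex.Re R)) /= /eqP.
  by rewrite eqr_nat => /eqP.
- by rewrite size_map size_iota.
Qed.

(** The shape matches coherent states, which depend on z antiholomorphically in the first slot of a
    form and holomorphically in the second. *)
Definition sesquipoly (H : C -> C -> C) := exists s : seq ({poly C} * {poly C}),
  forall u v, H u v = \sum_(pq <- s) (pq.1.[u])^* * pq.2.[v].

Lemma sesquipoly_sum (I : Type) (s : seq I) (H : I -> C -> C -> C) :
  (forall i, sesquipoly (H i)) -> sesquipoly (fun u v => \sum_(i <- s) H i u v).
Proof.
move=> hH; elim: s => [|i s [t ht]].
  by exists [::] => u v; rewrite !big_nil.
have [t' ht'] := hH i; exists (t' ++ t) => u v.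
by rewrite big_cons big_cat /= ht ht'.
Qed.

Lemma horner_conj (p : {poly C}) (u : C) : (p.[u])^* = (map_poly (@conjc R) p).[u^*].
Proof. by rewrite horner_map. Qed.

(* Writing u = x + i y and u^* = x - i y, a polynomial identity valid for all real
   x and y persists for complex x and y, where u^* and u are independent. *)
Lemma sesquipoly_diag0 (H : C -> C -> C) : sesquipoly H ->
  (forall u, H u u = 0) -> forall u v, H u v = 0.
Proof.
move=> [s hs] H0.
pose F (a b : C) := \sum_(pq <- s) (map_poly (@conjc R) pq.1).[a] * pq.2.[b].
have HF u v : H u v = F u^* v.
  by rewrite hs; apply: eq_bigr => pq _; congr (_ * _); exact: horner_conj.
pose I := ('i : C)%C.
(* For fixed real t, a polynomial in x that vanishes at every real x; [F2] then treats t in the same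
   way. *)
have F1 (x : C) (t : R) : F (x - I * t%:C) (x + I * t%:C) = 0.
  pose P := \sum_(pq <- s) ((map_poly (@conjc R) pq.1) \Po ('X - (I * t%:C)%:P)) *
     (pq.2 \Po ('X + (I * t%:C)%:P)).
  have PE y : P.[y] = F (y - I * t%:C) (y + I * t%:C).
    rewrite horner_sum; apply: eq_bigr => pq _.
    by rewrite hornerM !horner_comp !hornerE.
  rewrite -PE (poly_real_eq0 P) ?horner0 // => y; rewrite PE -[RHS](H0 (y%:C + I * t%:C)) HF.
  by congr F; apply: complexP; rewrite !cE /=; ring.
have F2 (x y : C) : F (x - I * y) (x + I * y) = 0.
  pose P := \sum_(pq <- s) ((map_poly (@conjc R) pq.1) \Po (x%:P - I%:P * 'X)) *
     (pq.2 \Po (x%:P + I%:P * 'X)).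
  have PE z : P.[z] = F (x - I * z) (x + I * z).
    rewrite horner_sum; apply: eq_bigr => pq _.
    by rewrite hornerM !horner_comp !hornerE.
  by rewrite -PE (poly_real_eq0 P) ?horner0 // => t; rewrite PE F1.
move=> u v; rewrite HF.
have II : I * I = -1 by apply: complexP; rewrite !cE /=; ring.
have h2 : 2^-1 * 2 = 1 :> C by rewrite mulVf // pnatr_eq0.
(* The solution x, y of x - i y = conj u and x + i y = v. *)
rewrite -[RHS](F2 (2^-1 * (u^* + v)) (I * (2^-1 * (u^* - v)))) !mulrA II.
congr F.
- transitivity (2^-1 * 2 * u^*); [by rewrite h2 mul1r | ring].
- transitivity (2^-1 * 2 * v); [by rewrite h2 mul1r | ring].
Qed.

Lemma cnorm_horner_le (p : {poly C}) (t : R) : 0 <= t <= 1 ->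
  cnorm p.[t%:C] <= \sum_(i < size p) cnorm p`_i.
Proof.
move=> /andP[t0 t1]; rewrite horner_coef; apply: le_trans (cnorm_sum _ _ _) _.
apply: ler_sum => i _; rewrite mulrC -rmorphXn /= cnormZ -[leRHS]mul1r.
apply: ler_wpM2r; first exact: cnorm_ge0.
by rewrite ger0_norm ?exprn_ge0 // exprn_ile1.
Qed.

Lemma le0_small (c K : R) : (forall t, 0 < t <= 1 -> c <= K * t) -> c <= 0.
Proof.
move=> h; rewrite leNgt; apply/negP => c0.
have K0 : 0 < K by apply: lt_le_trans c0 _; rewrite -[K]mulr1; apply: h; rewrite ltr01 lexx.
(* At this t, the value K t is smaller than c. *)
have := h (c / (2 * K + c)).
have d0 : 0 < 2 * K + c by lra.
rewrite divr_gt0 // ler_pdivrMr // => /(_ _)/wrap[|]; first by lra.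
rewrite mulrA ler_pdivlMr //; nra.
Qed.

(** The constant coefficient is O(t), hence 0; dividing by X then lowers the order M and all indices
    by one. *)
Lemma poly_small_coef (M : nat) (p : {poly C}) (K : R) :
  (forall t, 0 < t <= 1 -> cnorm p.[t%:C] <= K * t ^+ M) ->
  forall i, (i < M)%N -> p`_i = 0.
Proof.
elim: M p => [//|M IH] p hp.
have [q [c pE]] : exists q c, p = q * 'X + c%:P.
  by elim/poly_ind: p {hp} => [|q c _]; [exists 0, 0; rewrite mul0r addr0|exists q, c].
have pt t : p.[t%:C] = t%:C * q.[t%:C] + c by rewrite pE !hornerE mulrC.
have c0 : c = 0.
  apply: cnorm0_eq0; apply: (le0_small _ (`|K| + \sum_(i < size q) cnorm q`_i)) => t /andP[t0 t1].
  have -> : c = p.[t%:C] + (- t)%:C * q.[t%:C].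
    by rewrite pt; apply: complexP; rewrite !cE /=; ring.
  apply: le_trans (cnormD _ _) _; rewrite mulrDl; apply: lerD.
    apply: le_trans (hp t _) _; first by rewrite t0.
    rewrite exprS; apply: le_trans (ler_wpM2r _ (ler_norm K)) _.
      by rewrite mulr_ge0 ?exprn_ge0 // ltW.
    apply: ler_wpM2l => //; rewrite -[leRHS]mulr1; apply: ler_wpM2l; first exact: ltW.
    by rewrite exprn_ile1 // ltW.
  rewrite cnormZ normrN (gtr0_norm t0) mulrC; apply: ler_wpM2r; first exact: ltW.
  by apply: cnorm_horner_le; rewrite (ltW t0).
have hq t : 0 < t <= 1 -> cnorm q.[t%:C] <= K * t ^+ M.
  move=> t01; have := hp t t01; rewrite pt c0 addr0 cnormZ; case/andP: t01 => t0 _.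
  by rewrite (gtr0_norm t0) exprS mulrCA ler_pM2l.
by case=> [|i] iM; rewrite pE c0 addr0 coefMX //=; exact: IH hq _ _.
Qed.

End ComplexPolynomials.

(** * Bounded sesquilinear forms and their truncations *)

Section Forms.
Context {R : realType} {n : nat}.
Notation C := R[i].
Variable hbar : R.
Implicit Types (phi psi : (nat -> R) -> C) (G : ((nat -> R) -> C) -> ((nat -> R) -> C) -> C).

Record bounded_form G : Prop := BoundedForm {
  form_linl : forall (a : C) phi phi' psi, L2 R n phi -> L2 R n phi' -> L2 R n psi ->
    G (fun x => a * phi x + phi' x) psi = a * G phi psi + G phi' psi;
  form_linr : forall (a : C) phi psi psi', L2 R n phi -> L2 R n psi -> L2 R n psi' ->
    G phi (fun x => a * psi x + psi' x) = a^* * G phi psi + G phi psi';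
  form_bound : exists2 K : R, 0 <= K & forall phi psi, L2 R n phi -> L2 R n psi ->
    cnorm (G phi psi) <= K * (l2norm R n phi * l2norm R n psi) }.

(** Carries results on the first argument of a form over to the second. *)
Lemma bounded_form_flip G : bounded_form G -> bounded_form (fun phi psi => (G psi phi)^*).
Proof.
move=> [l1 l2 [K K0 hK]]; split.
- by move=> a phi phi' psi L L' L''; rewrite l2 // rmorphD rmorphM /= conjcK.
- by move=> a phi psi psi' L L' L''; rewrite l1 // rmorphD rmorphM.
- by exists K => // phi psi L L'; rewrite cnormJ mulrC (mulrC (l2norm _ _ _)) mulrC; exact: hK.
Qed.

Lemma bounded_formB G G' : bounded_form G -> bounded_form G' ->
  bounded_form (fun phi psi => G phi psi - G' phi psi).
Proof.
move=> [l1 l2 [K K0 hK]] [l1' l2' [K' K0' hK']]; split.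
- by move=> a phi phi' psi L L' L''; rewrite l1 // l1' //; ring.
- by move=> a phi psi psi' L L' L''; rewrite l2 // l2' //; ring.
- exists (K + K'); first exact: addr_ge0.
  move=> phi psi L L'; apply: le_trans (cnormD _ _) _; rewrite mulrDl; apply: lerD.
    exact: hK.
  have -> : - G' phi psi = (-1)%:C * G' phi psi by rewrite rmorphN rmorph1 mulN1r.
  by rewrite cnormZ normrN1 mul1r; exact: hK'.
Qed.

Section Form.
Variable G : ((nat -> R) -> C) -> ((nat -> R) -> C) -> C.
Hypothesis bG : bounded_form G.

Lemma form0l psi : L2 R n psi -> G (fun=> 0) psi = 0.
Proof.
move=> L; have := form_linl _ bG 1 (fun=> 0) (fun=> 0) psi L2_0 L2_0 L.
under eq_fun do rewrite mul1r addr0.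
by rewrite mul1r => /eqP; rewrite -subr_eq subrr eq_sym => /eqP.
Qed.

Lemma form_suml (I : Type) (s : seq I) (c : I -> C) (e : I -> (nat -> R) -> C) psi :
  (forall i, L2 R n (e i)) -> L2 R n psi ->
  G (fun x => \sum_(i <- s) c i * e i x) psi = \sum_(i <- s) c i * G (e i) psi.
Proof.
move=> Le L; elim: s => [|i s IH].
  by under eq_fun do rewrite big_nil; rewrite big_nil form0l.
under eq_fun do rewrite big_cons.
rewrite big_cons (form_linl _ bG) ?IH //.
by apply: L2_sum => j; exact: L2Z.
Qed.

Lemma form_sumr (I : Type) (s : seq I) (c : I -> C) (e : I -> (nat -> R) -> C) phi :
  (forall i, L2 R n (e i)) -> L2 R n phi ->
  G phi (fun x => \sum_(i <- s) c i * e i x) = \sum_(i <- s) (c i)^* * G phi (e i).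
Proof.
move=> Le L; elim: s => [|i s IH].
  under eq_fun do rewrite big_nil; rewrite big_nil.
  have := form_linr _ bG 1 phi (fun=> 0) (fun=> 0) L L2_0 L2_0.
  under eq_fun do rewrite mul1r addr0.
  by rewrite rmorph1 mul1r => /eqP; rewrite -subr_eq subrr eq_sym => /eqP.
under eq_fun do rewrite big_cons.
rewrite big_cons (form_linr _ bG) ?IH //.
by apply: L2_sum => j; exact: L2Z.
Qed.

Lemma formBl phi phi' psi : L2 R n phi -> L2 R n phi' -> L2 R n psi ->
  G (fun x => phi x - phi' x) psi = G phi psi - G phi' psi.
Proof.
move=> L L' L''; have := form_linl _ bG (-1) phi' phi psi L' L L''.
by under eq_fun do rewrite mulN1r addrC; rewrite mulN1r addrC.
Qed.

Lemma formBr phi psi psi' : L2 R n phi -> L2 R n psi -> L2 R n psi' ->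
  G phi (fun x => psi x - psi' x) = G phi psi - G phi psi'.
Proof.
move=> L L' L''; have := form_linr _ bG (-1) phi psi' psi L L'' L'.
by under eq_fun do rewrite mulN1r addrC; rewrite rmorphN rmorph1 mulN1r addrC.
Qed.

Notation Phi a := (Phi R hbar a).
Notation Phit a m := (Phi_trunc hbar a m).
Notation e a l := (eterm hbar a l).
Implicit Types a b : 'cV[C]_n.+1.

Definition block l k a b : C := G (e a l) (e b k).

Lemma form_truncE a b m : G (Phit a m) (Phit b m) =
  \sum_(l < m) \sum_(k < m) block l k a b.
Proof.
have tE (d : 'cV[C]_n.+1) : Phit d m = fun x => \sum_(l < m) 1 * e d l x.
  by apply/funext => x; apply: eq_bigr => l _; rewrite mul1r.
rewrite (tE a) form_suml; [|by move=> l; exact: L2_eterm|exact: L2_Phi_trunc].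
apply: eq_bigr => l _; rewrite mul1r (tE b) form_sumr; [|by move=> k; exact: L2_eterm|exact: L2_eterm].
by apply: eq_bigr => k _; rewrite rmorph1 mul1r.
Qed.

(** One argument is truncated at a time; each norm bound on a coherent state brings a factor 2,
    whence the 4. *)
Lemma form_trunc_err : exists2 K : R, 0 <= K & forall a b m,
  cnorm (G (Phi a) (Phi b) - G (Phit a m) (Phit b m)) <=
  K * (exp_tail (growth hbar a) m * expR (growth hbar b) + expR (growth hbar a) * exp_tail (growth hbar b) m).
Proof.
have [K K0 hK] := form_bound _ bG; exists (4 * K); first exact: mulr_ge0.
move=> a b m.
have La := L2_Phi hbar a; have Lb := L2_Phi hbar b.
have Ta := L2_Phi_trunc hbar a m; have Tb := L2_Phi_trunc hbar b m.
have -> : G (Phi a) (Phi b) - G (Phit a m) (Phit b m) =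
    G (fun x => Phi a x - Phit a m x) (Phi b) + G (Phit a m) (fun x => Phi b x - Phit b m x).
  by rewrite formBl // formBr //; ring.
have ra := growth_ge0 hbar a; have rb := growth_ge0 hbar b.
have ea := expR_ge0 (growth hbar a); have eb := expR_ge0 (growth hbar b).
have ta := exp_tail_ge0 _ m ra; have tb := exp_tail_ge0 _ m rb.
apply: le_trans (cnormD _ _) _; rewrite mulrDr; apply: lerD.
- apply: le_trans (hK _ _ (L2B _ _ La Ta) Lb) _.
  rewrite -[leRHS]mulrA [leRHS]mulrCA; apply: ler_wpM2l => //.
  apply: le_trans (ler_pM _ _ (l2norm_Phi_tail hbar a m) (l2norm_Phi hbar b)) _; rewrite ?l2norm_ge0 //.
  by rewrite le_eqVlt; apply/orP; left; apply/eqP; ring.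
- apply: le_trans (hK _ _ Ta (L2B _ _ Lb Tb)) _.
  rewrite -[leRHS]mulrA [leRHS]mulrCA; apply: ler_wpM2l => //.
  apply: le_trans (ler_pM _ _ (l2norm_Phi_trunc hbar a m) (l2norm_Phi_tail hbar b m)) _; rewrite ?l2norm_ge0 //.
  by rewrite le_eqVlt; apply/orP; left; apply/eqP; ring.
Qed.

Lemma form_trunc_cvg a b :
  (exp_tail (growth hbar a) m * expR (growth hbar b) + expR (growth hbar a) * exp_tail (growth hbar b) m)
  @[m --> \oo] --> 0.
Proof.
rewrite -[X in _ --> X](_ : 0 * expR (growth hbar b) + expR (growth hbar a) * 0 = 0); last by ring.
by apply: cvgD; [apply: cvgMl|apply: cvgMr]; exact: exp_tail_cvg0.
Qed.

Lemma blockZl (s : R) l k a b : block l k (s%:C *: a) b = (s ^+ l)%:C * block l k a b.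
Proof.
(* The zero term brings the right-hand side to the shape of [form_linl]. *)
rewrite /block -[RHS]addr0 -[X in _ + X](form0l (e b k)); last exact: L2_eterm.
rewrite -(form_linl _ bG); [|exact: L2_eterm|exact: L2_0|exact: L2_eterm].
by congr G; apply/funext => x; rewrite eterm_scale addr0.
Qed.

Lemma blockZr (s : R) l k a b : block l k a (s%:C *: b) = (s ^+ k)%:C * block l k a b.
Proof.
have -> : block l k a (s%:C *: b) = \sum_(i <- [:: tt]) ((s ^+ k)%:C)^* * G (e a l) (e b k).
  rewrite /block -(form_sumr _ [:: tt] (fun=> (s ^+ k)%:C) (fun=> e b k)).
  - by congr G; apply/funext => x; rewrite big_seq1 eterm_scale.
  - by move=> _; exact: L2_eterm.
  - exact: L2_eterm.
by rewrite big_seq1 /block; congr (_ * _); exact: conjc_real.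
Qed.

Lemma block_monomial l k a b : block l k a b =
  \sum_(f : {ffun 'I_l -> 'I_n.+1}) \sum_(h : {ffun 'I_k -> 'I_n.+1})
    mcoef hbar l a f * (mcoef hbar k b h)^* * G (monomial l f) (monomial k h).
Proof.
have eE j (d : 'cV[C]_n.+1) : e d j = fun x => \sum_(f : {ffun 'I_j -> 'I_n.+1}) mcoef hbar j d f * monomial j f x.
  by apply/funext => x; exact: eterm_monomial.
rewrite /block (eE l a) form_suml; [|by move=> f; exact: L2_monomial|exact: L2_eterm].
apply: eq_bigr => f _; rewrite (eE k b) form_sumr; [|by move=> h; exact: L2_monomial|exact: L2_monomial].
by rewrite mulr_sumr; apply: eq_bigr => h _; rewrite mulrA.
Qed.

End Form.
End Forms.

(** * rho and the monomial coefficients along complex lines *)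

Section Lines.
Context {R : realType}.
Notation C := R[i].
Implicit Types (c : nm_case).

Lemma crd_line k (z v : 'cV[C]_k) (u : C) s : crd R (z + u *: v) s = crd R z s + u * crd R v s.
Proof. by rewrite /crd; case: insub => [i|]; rewrite ?mxE // mulr0 addr0. Qed.

Lemma crdZ k (z : 'cV[C]_k) (u : C) s : crd R (u *: z) s = u * crd R z s.
Proof. by rewrite /crd; case: insub => [i|]; rewrite ?mxE // mulr0. Qed.

Lemma rhoZ c (s : R) (z : 'cV[C]_(mdim c)) : rho R c (s%:C *: z) = (s ^+ 2)%:C *: rho R c z.
Proof.
apply/matrixP => i j; rewrite !mxE rmorphXn /=.
by case: c z i => z [[|[|[|[|[|[|i]]]]]] Hi] //=; rewrite /rho_comp /= !crdZ; ring.
Qed.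

Definition polyfun (F : C -> C) := exists p : {poly C}, forall u, F u = p.[u].

Lemma polyfun_cst (a : C) : polyfun (fun=> a).
Proof. by exists a%:P => u; rewrite hornerC. Qed.

Lemma polyfunD F H : polyfun F -> polyfun H -> polyfun (fun u => F u + H u).
Proof. by move=> [p hp] [q hq]; exists (p + q) => u; rewrite hp hq hornerD. Qed.

Lemma polyfunM F H : polyfun F -> polyfun H -> polyfun (fun u => F u * H u).
Proof. by move=> [p hp] [q hq]; exists (p * q) => u; rewrite hp hq hornerM. Qed.

Lemma polyfunN F : polyfun F -> polyfun (fun u => - F u).
Proof. by move=> [p hp]; exists (- p) => u; rewrite hp hornerN. Qed.

Lemma polyfun_prod (I : Type) (s : seq I) (F : I -> C -> C) :
  (forall i, polyfun (F i)) -> polyfun (fun u => \prod_(i <- s) F i u).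
Proof.
move=> hF; elim: s => [|i s [p hp]]; first by exists 1 => u; rewrite big_nil hornerC.
by have [q hq] := hF i; exists (q * p) => u; rewrite big_cons hp hq hornerM.
Qed.

Lemma polyfun_crd k (z v : 'cV[C]_k) s : polyfun (fun u => crd R (z + u *: v) s).
Proof.
by exists ((crd R z s)%:P + crd R v s *: 'X) => u; rewrite crd_line !hornerE mulrC.
Qed.

Lemma polyfun_rho c (z v : 'cV[C]_(mdim c)) (j : 'I_(ndim c).+1) :
  polyfun (fun u => rho R c (z + u *: v) j 0).
Proof.
under eq_fun do rewrite mxE.
have X := polyfun_crd _ z v; have K := polyfun_cst.
rewrite /rho_comp; case: c z v j X => z v [[|[|[|[|[|[|j]]]]]] Hj] //= X;
  rewrite ?expr2; repeat first [exact: X | exact: K | apply: polyfunD | apply: polyfunM | apply: polyfunN].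
Qed.

(** rho is polynomial along the line, and [dotx] conjugates the parameter of the coherent state. *)
Lemma mcoef_line c (hbar : R) l (f : {ffun 'I_l -> 'I_(ndim c).+1}) (z v : 'cV[C]_(mdim c)) :
  exists P : {poly C}, forall u, mcoef hbar l (rho R c (z + u *: v)) f = (P.[u])^*.
Proof.
set k : C := (ccoef R (ndim c) l)%:C * (hbar%:C)^-1 ^+ l.
have [P hP] : polyfun (fun u => k^* * \prod_(i < l) rho R c (z + u *: v) (f i) 0).
  apply: polyfunM; first exact: polyfun_cst.
  by apply: polyfun_prod => i; exact: polyfun_rho.
by exists P => u; rewrite -hP rmorphM rmorph_prod /= conjcK.
Qed.

Lemma cmeas_crd k (s : nat) : cmeas (2 * k) (fun x => crd R (toCv R k x) s).
Proof.
rewrite /crd; case: insubP => [i _ _|_]; last exact: cmeas_cst.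
have ik := ltn_ord i.
under eq_fun do rewrite mxE.
by split => /=; apply: kmeas_coord; lia.
Qed.

Lemma cmeas_rho c (j : 'I_(ndim c).+1) :
  cmeas (2 * mdim c) (fun x => rho R c (toCv R (mdim c) x) j 0).
Proof.
under eq_fun do rewrite mxE.
have X := cmeas_crd (mdim c); have K := @cmeas_cst R (2 * mdim c).
rewrite /rho_comp; case: c j X K => [] [[|[|[|[|[|[|j]]]]]] Hj] //= X K;
  repeat first [exact: X | exact: K | apply: cmeasD | apply: cmeasM | apply: cmeasN | apply: cmeasX].
Qed.

Lemma cmeas_mcoef c (hbar : R) l (f : {ffun 'I_l -> 'I_(ndim c).+1}) :
  cmeas (2 * mdim c) (fun x => mcoef hbar l (rho R c (toCv R (mdim c) x)) f).
Proof.
apply: cmeasM; first exact: cmeas_cst.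
by apply: cmeas_prod => i; apply: cmeasJ; exact: cmeas_rho.
Qed.

End Lines.

(** * Forms that vanish on the diagonal of coherent states *)

Section CoherentForms.
Context {R : realType} {c : nm_case}.
Notation C := R[i].
Notation n := (ndim c).
Notation m := (mdim c).
Variables (hbar : R) (G : ((nat -> R) -> C) -> ((nat -> R) -> C) -> C).
Hypothesis bG : @bounded_form R n G.
Notation PhiZ := (PhiR R c hbar).
Notation blk l k z w := (block hbar G l k (rho R c z) (rho R c w)).

Lemma sesquipoly_block l k (z v : 'cV[C]_m) :
  sesquipoly (fun s t => blk l k (z + s *: v) (z + t *: v)).
Proof.
have [H hH] : exists H : C -> C -> C, sesquipoly H /\
    forall s t, H s t = blk l k (z + s *: v) (z + t *: v).
  exists (fun s t => \sum_(f : {ffun 'I_l -> 'I_n.+1}) \sum_(h : {ffun 'I_k -> 'I_n.+1})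
    mcoef hbar l (rho R c (z + s *: v)) f * (mcoef hbar k (rho R c (z + t *: v)) h)^* *
    G (monomial l f) (monomial k h)); split; last by move=> s t; rewrite block_monomial.
  apply: sesquipoly_sum => f; apply: sesquipoly_sum => h.
  have [P hP] := mcoef_line c hbar l f z v; have [Q hQ] := mcoef_line c hbar k h z v.
  exists [:: (P, Q * (G (monomial l f) (monomial k h))%:P)] => s t.
  rewrite big_seq1 /= hP hQ hornerM hornerC -mulrA.
  by congr (_ * (_ * _)); exact: conjcK.
case: hH => [[s hs] HE]; exists s => a b; rewrite -hs -HE //.
Qed.

(* The component of total degree N of the form on coherent states. *)
Definition Sblk N (z w : 'cV[C]_m) : C :=
  \sum_(l < N.+1) \sum_(k < N.+1) (if (l + k == N)%N then blk l k z w else 0).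

(** As the form vanishes at t z, its truncation to l, k <= N is minus the truncation error, which is
    O(t^(2(N+1))) because rho (t z) = t^2 rho z. Such a polynomial in t has no coefficient in degree
    2N, and the truncation contains every pair with l + k = N. *)
Lemma Sblk_diag N z : (forall z, G (PhiZ z) (PhiZ z) = 0) -> Sblk N z z = 0.
Proof.
move=> G0; pose p := \sum_(l < N.+1) \sum_(k < N.+1) blk l k z z *: 'X^(2 * (l + k)).
have pE t : p.[t%:C] = G (Phi_trunc hbar (rho R c (t%:C *: z)) N.+1)
                        (Phi_trunc hbar (rho R c (t%:C *: z)) N.+1).
  rewrite form_truncE // horner_sum; apply: eq_bigr => l _; rewrite horner_sum.
  apply: eq_bigr => k _; rewrite rhoZ blockZl // blockZr // !hornerE [LHS]mulrC; congr (_ * _).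
  by rewrite -[LHS]rmorphXn /= mulnDr exprD !exprM rmorphM.
have [K K0 hK] := form_trunc_err hbar G bG.
set y := growth hbar (rho R c z); have y0 : 0 <= y := growth_ge0 _ _.
have hp t : 0 < t <= 1 -> cnorm p.[t%:C] <= (K * (2 * expR y * exp_tail y N.+1)) * t ^+ (2 * N.+1).
  move=> /andP[t0 t1]; have := hK (rho R c (t%:C *: z)) (rho R c (t%:C *: z)) N.+1.
  have := G0 (t%:C *: z); rewrite /PhiR => ->; rewrite -pE sub0r.
  have -> : - p.[t%:C] = (-1)%:C * p.[t%:C] by rewrite rmorphN rmorph1 mulN1r.
  rewrite cnormZ normrN1 mul1r => h; apply: le_trans h _.
  rewrite -mulrA; apply: ler_wpM2l => //.
  rewrite rhoZ growthZ ?sqr_ge0 // -/y.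
  have s1 : 0 <= t ^+ 2 <= 1 by rewrite sqr_ge0 exprn_ile1 // ltW.
  have e1 : expR (t ^+ 2 * y) <= expR y.
    by rewrite ler_expR -[leRHS]mul1r; apply: ler_wpM2r => //; case/andP: s1.
  have e2 := exp_tail_scale _ _ N.+1 s1 y0; rewrite -exprM in e2.
  have e3 : 0 <= exp_tail (t ^+ 2 * y) N.+1 by apply: exp_tail_ge0; rewrite mulr_ge0 ?sqr_ge0.
  have e4 := ler_pM e3 (expR_ge0 _) e2 e1.
  by lra.
have := poly_small_coef (2 * N.+1) p _ hp (2 * N)%N; rewrite ltn_pmul2l // => /(_ (ltnSn N)) <-.
rewrite coef_sum; apply: eq_bigr => l _; rewrite coef_sum; apply: eq_bigr => k _.
by rewrite coefZ coefXn eqn_pmul2l // eq_sym; case: eqP => _; rewrite ?mulr1 ?mulr0.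
Qed.

(** Polarization on the complex line through z and w. *)
Lemma Sblk_eq0 N z w : (forall z, G (PhiZ z) (PhiZ z) = 0) -> Sblk N z w = 0.
Proof.
move=> G0; pose v := w - z.
pose H s t := Sblk N (z + s *: v) (z + t *: v).
have <- : H 0 1 = Sblk N z w by rewrite /H scale0r addr0 scale1r /v addrC subrK.
apply: sesquipoly_diag0 => [|u]; last exact: Sblk_diag.
apply: sesquipoly_sum => l; apply: sesquipoly_sum => k.
case: (_ == _); first exact: sesquipoly_block.
by exists [::] => s t; rewrite big_nil.
Qed.

Lemma block_eq0 l k z w : (forall z, G (PhiZ z) (PhiZ z) = 0) -> blk l k z w = 0.
Proof.
move=> G0; pose N := (l + k)%N.
(* Scaling z alone by a real s multiplies the block (i, j) by s^(2i); the coefficient in degree 2l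
   leaves i = l and hence j = N - l = k. *)
pose p := \sum_(i < N.+1) \sum_(j < N.+1) (if (i + j == N)%N then blk i j z w else 0) *: 'X^(2 * i).
have p0 : p = 0.
  apply: poly_real_eq0 => s; rewrite -[RHS](Sblk_eq0 N (s%:C *: z) w G0).
  rewrite horner_sum; apply: eq_bigr => i _; rewrite horner_sum; apply: eq_bigr => j _.
  rewrite !hornerE rhoZ; case: ifP => _; last by rewrite mul0r.
  by rewrite blockZl // -exprM rmorphXn mulrC.
have lN : (l < N.+1)%N by rewrite ltnS leq_addr.
have kN : (k < N.+1)%N by rewrite ltnS leq_addl.
have := congr1 (fun q : {poly C} => q`_(2 * l)) p0.
rewrite coef0 coef_sum (bigD1 (Ordinal lN)) //= [X in _ + X]big1 ?addr0; last first.
  move=> i il; rewrite coef_sum big1 // => j _.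
  rewrite coefZ coefXn eqn_pmul2l //.
  have -> : (l == i) = false by apply/negbTE; apply: contraNneq il => li; apply/eqP; apply: val_inj.
  by rewrite mulr0.
rewrite coef_sum (bigD1 (Ordinal kN)) //= [X in _ + X]big1 ?addr0; last first.
  move=> j jk; case: eqP => [h|_]; last by rewrite scale0r coef0.
  by case/eqP: jk; apply: val_inj => /=; apply/eqP; rewrite -(eqn_add2l l) h.
by rewrite eqxx coefZ coefXn eqxx mulr1.
Qed.

(** All truncations vanish, so the form equals its truncation error, which tends to 0. *)
Lemma form_diag0 z w : (forall z, G (PhiZ z) (PhiZ z) = 0) -> G (PhiZ z) (PhiZ w) = 0.
Proof.
move=> G0; apply: cnorm0_eq0.
have [K K0 hK] := form_trunc_err hbar G bG.
pose b M := K * (exp_tail (growth hbar (rho R c z)) M * expR (growth hbar (rho R c w))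
  + expR (growth hbar (rho R c z)) * exp_tail (growth hbar (rho R c w)) M).
have cb : b @ \oo --> 0.
  by rewrite -(mulr0 K); apply: cvgMr; exact: form_trunc_cvg.
rewrite -(cvg_lim _ cb) //; apply: limr_ge; first by apply/cvg_ex; exists 0.
exists 0%N => // M _ /=; apply: le_trans (hK _ _ M).
rewrite form_truncE // big1 ?subr0 // => l _; rewrite big1 // => k _.
exact: block_eq0.
Qed.

(** Truncating the coherent state gives polynomials in the real coordinates of the point of C^m,
    which converge pointwise. This makes the integrand of the star product measurable. *)
Lemma cmeas_form psi : L2 R n psi ->
  cmeas (2 * m) (fun x => G (PhiZ (toCv R m x)) psi).
Proof.
move=> Lp; have [K K0 hK] := form_bound _ bG.
pose a x := rho R c (toCv R m x).
apply: (cmeas_cvg _ (fun M x => G (Phi_trunc hbar (a x) M) psi) _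
   (fun x M => K * l2norm R n psi * 2 * exp_tail (growth hbar (a x)) M)).
- move=> M.
  have E x : G (Phi_trunc hbar (a x) M) psi = \sum_(l < M) \sum_(f : {ffun 'I_l -> 'I_n.+1})
      mcoef hbar l (a x) f * G (monomial l f) psi.
    have tE : Phi_trunc hbar (a x) M = fun y => \sum_(l < M) 1 * eterm hbar (a x) l y.
      by apply/funext => y; apply: eq_bigr => l _; rewrite mul1r.
    rewrite tE (form_suml _ bG) //; last by move=> l; exact: L2_eterm.
    apply: eq_bigr => l _; rewrite mul1r.
    have -> : eterm hbar (a x) l = fun y => \sum_(f : {ffun 'I_l -> 'I_n.+1}) mcoef hbar l (a x) f * monomial l f y.
      by apply/funext => y; exact: eterm_monomial.
    by rewrite (form_suml _ bG) // => f; exact: L2_monomial.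
  under eq_fun do rewrite E.
  apply: cmeas_sum => l; apply: cmeas_sum => f; apply: cmeasM; last exact: cmeas_cst.
  exact: cmeas_mcoef.
- move=> x M; have La := L2_Phi hbar (a x); have Lt := L2_Phi_trunc hbar (a x) M.
  rewrite /PhiR -(formBl _ bG) //; apply: le_trans (hK _ _ (L2B _ _ La Lt) Lp) _.
  rewrite -!mulrA; apply: ler_wpM2l => //; rewrite mulrC; apply: ler_wpM2l; first exact: l2norm_ge0.
  exact: l2norm_Phi_tail.
- move=> x; rewrite -(mulr0 (K * l2norm R n psi * 2)); apply: cvgMr; exact: exp_tail_cvg0.
Qed.

End CoherentForms.

(** * Covariance of the symbols and of the star product *)

Section BoundedOperators.
Context {R : realType} {n : nat}.
Notation C := R[i].
Implicit Types (phi psi : (nat -> R) -> C) (A : ((nat -> R) -> C) -> ((nat -> R) -> C)).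

Lemma bounded_form_ip : @bounded_form R n (ip R n).
Proof.
have linr (a : C) phi psi psi' : L2 R n phi -> L2 R n psi -> L2 R n psi' ->
    ip R n phi (fun x => a * psi x + psi' x) = a^* * ip R n phi psi + ip R n phi psi'.
  move=> L L' L''; rewrite (ipJ _ _ (L2_lin a _ _ L' L'') L) ip_lin //.
  by rewrite (ipJ _ _ L' L) (ipJ _ _ L'' L) rmorphD rmorphM.
split=> //; first by move=> a phi phi' psi L L' L''; exact: ip_lin.
by exists 2 => // phi psi L L'; exact: cnorm_ip_le.
Qed.

(** A is linear only up to functions of norm 0; pairing with psi removes the ambiguity, by
    [l2norm0_ip]. *)
Lemma bounded_form_op A : bounded_op R n A -> @bounded_form R n (fun phi psi => ip R n (A phi) psi).
Proof.
move=> [AL Alin [K hK]]; split.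
- move=> a phi phi' psi L L' L''.
  have LA := AL _ (L2_lin a _ _ L L'); have LB := L2_lin a _ _ (AL _ L) (AL _ L').
  have := l2norm0_ip _ _ (L2B _ _ LA LB) L'' (Alin a _ _ L L').
  rewrite (formBl _ bounded_form_ip) // => /eqP; rewrite subr_eq0 => /eqP ->.
  by rewrite ip_lin //; exact: AL.
- move=> a phi psi psi' L L' L''; apply: (form_linr _ bounded_form_ip) => //; exact: AL.
- exists (2 * `|K|) => [|phi psi L L']; first exact: mulr_ge0.
  apply: le_trans (cnorm_ip_le _ _ (AL _ L) L') _; rewrite -mulrA; apply: ler_wpM2l => //.
  rewrite mulrA; apply: ler_wpM2r; first exact: l2norm_ge0.
  apply: le_trans (hK _ L) _; apply: ler_wpM2r; [exact: l2norm_ge0|exact: ler_norm].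
Qed.

Variable M : 'M[R]_n.+1.
Hypothesis MM : M^T *m M = 1%:M.

Let MMt : M^T^T *m M^T = 1%:M.
Proof. by rewrite trmxK; exact: mulmx1C. Qed.

Definition conj_op A : ((nat -> R) -> C) -> ((nat -> R) -> C) :=
  fun phi => rotfun M (A (rotfun M^T phi)).

Lemma bounded_op_conj A : bounded_op R n A -> bounded_op R n (conj_op A).
Proof.
move=> [AL Alin [K hK]].
have Lt phi : L2 R n phi -> L2 R n (rotfun M^T phi) by move=> L; exact: L2_rot.
split.
- by move=> phi L; apply: L2_rot => //; apply: AL; exact: Lt.
- move=> a phi psi L L'; rewrite -[RHS](Alin a _ _ (Lt _ L) (Lt _ L')).
  apply: (l2norm_rot M MM (fun x => A (fun y => a * rotfun M^T phi y + rotfun M^T psi y) x -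
    (a * A (rotfun M^T phi) x + A (rotfun M^T psi) x))).
  apply: L2B; first by apply: AL; apply: L2_lin; exact: Lt.
  by apply: L2_lin; apply: AL; exact: Lt.
- exists K => phi L; rewrite /conj_op (l2norm_rot M MM); last by apply: AL; exact: Lt.
  by apply: le_trans (hK _ (Lt _ L)) _; rewrite (l2norm_rot _ MMt).
Qed.

Lemma dotx_mulmx (a : 'cV[C]_n.+1) x :
  dotx R x (map_mx (real_complex R) M *m a) = dotx R (mxact n.+1 M^T x) a.
Proof.
rewrite /dotx; under eq_bigr do rewrite mxE rmorph_sum /= mulr_sumr.
rewrite exchange_big /=; apply: eq_bigr => k _.
rewrite mxact_ord rmorph_sum /= mulr_suml; apply: eq_bigr => s _.
by rewrite !mxE; apply: complexP; rewrite !cE /=; ring.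
Qed.

Lemma Phi_mulmx hbar (a : 'cV[C]_n.+1) :
  Phi R hbar (map_mx (real_complex R) M *m a) = rotfun M^T (Phi R hbar a).
Proof.
apply/funext => x; rewrite /rotfun /Phi; congr csum; apply/funext => l.
by rewrite dotx_mulmx.
Qed.

End BoundedOperators.

(** * Invariance of the Gaussian measure under unitary matrices *)

Section GaussianInvariance.
Context {R : realType}.
Notation C := R[i].

Definition entry m (L : 'M[C]_m) (s t : nat) : C :=
  if insub s is Some i then if insub t is Some j then L i j else 0 else 0.

(* The real 2m x 2m matrix of L under the identification [toCv]. *)
Definition realify m (L : 'M[C]_m) : 'M[R]_(2 * m) := \matrix_(i, j)
  let z := entry m L i./2 j./2 in
  if odd i then (if odd j then complex.Re z else complex.Im z)
  else (if odd j then - complex.Im z else complex.Re z).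

Lemma sum_pairs (F : nat -> R) m :
  \sum_(j < 2 * m) F j = \sum_(t < m) (F (2 * t)%N + F (2 * t).+1).
Proof.
elim: m => [|m IH]; first by rewrite muln0 !big_ord0.
by rewrite mulnS add2n 2!big_ord_recr [RHS]big_ord_recr /= -IH addrA.
Qed.

Lemma toCv_realify m (L : 'M[C]_m) x : toCv R m (mxact (2 * m) (realify m L) x) = L *m toCv R m x.
Proof.
have half2 s : (2 * s)./2 = s by rewrite mul2n doubleK.
have half2S s : uphalf (2 * s) = s by rewrite mul2n uphalf_double.
have odd2 s : odd (2 * s) = false by rewrite mul2n odd_double.
apply/matrixP => s j; rewrite !mxE.
have s0 : (2 * s < 2 * m)%N by have := ltn_ord s; lia.
have s1 : ((2 * s).+1 < 2 * m)%N by have := ltn_ord s; lia.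
pose F0 l := (let z := entry m L s l./2 in if odd l then - complex.Im z else complex.Re z) * x l.
pose F1 l := (let z := entry m L s l./2 in if odd l then complex.Re z else complex.Im z) * x l.
rewrite !mxact_lt.
have -> : \sum_(l < 2 * m) realify m L (Ordinal s0) l * x l = \sum_(l < 2 * m) F0 l.
  by apply: eq_bigr => l _; rewrite mxE /= odd2 half2.
have -> : \sum_(l < 2 * m) realify m L (Ordinal s1) l * x l = \sum_(l < 2 * m) F1 l.
  by apply: eq_bigr => l _; rewrite mxE /= odd2 /= half2S.
rewrite !sum_pairs; apply: complexP; rewrite ?Re_sum ?Im_sum /=; apply: eq_bigr => t _;
  rewrite /F0 /F1 /= odd2 /= half2 half2S /entry !valK !mxE !cE /=; ring.
Qed.

Lemma nrmsq_toCv m (x : nat -> R) : nrmsq R (2 * m) x = \sum_(s < m) sqmod R (toCv R m x s 0).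
Proof.
rewrite /nrmsq (sum_pairs (fun j => x j ^+ 2)); apply: eq_bigr => s _.
by rewrite mxE.
Qed.

Lemma nrmsq_realify m (L : 'M[C]_m) x : adjmx R L *m L = 1%:M ->
  nrmsq R (2 * m) (mxact (2 * m) (realify m L) x) = nrmsq R (2 * m) x.
Proof.
move=> LL; rewrite !nrmsq_toCv toCv_realify.
have E (v : 'cV[C]_m) : (\sum_(s < m) sqmod R (v s 0))%:C = ((map_mx (@conjc R) v)^T *m v) 0 0.
  rewrite rmorph_sum mxE; apply: eq_bigr => s _; rewrite !mxE.
  by apply: complexP; rewrite !cE /= /sqmod; ring.
apply: (@complexI R); rewrite !E map_mxM trmx_mul -mulmxA (mulmxA _ L).
by have := LL; rewrite /adjmx => ->; rewrite mul1mx.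
Qed.

Lemma cint_mxact k (M : 'M[R]_k) (F : (nat -> R) -> C) :
  (forall x, nrmsq R k (mxact k M x) = nrmsq R k x) -> cmeas k F ->
  cint R k (fun x => F (mxact k M x)) = cint R k F.
Proof.
move=> MM [m1 m2]; rewrite /cint; congr (_ +i* _).
- exact: (rint_mxact k M (fun x => complex.Re (F x))).
- exact: (rint_mxact k M (fun x => complex.Im (F x))).
Qed.

Lemma mu_int_unitary m hbar (L : 'M[C]_m) (F : 'cV[C]_m -> C) : adjmx R L *m L = 1%:M ->
  cmeas (2 * m) (fun x => F (toCv R m x)) ->
  mu_int R hbar (fun u => F (L *m u)) = mu_int R hbar F.
Proof.
move=> LL mF; rewrite /mu_int; congr (_ * _).
pose H x := F (toCv R m x) * (expR (- nrmsq R (2 * m) x / hbar))%:C.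
transitivity (cint R (2 * m) (fun x => H (mxact (2 * m) (realify m L) x))).
  by congr cint; apply/funext => x; rewrite /H toCv_realify nrmsq_realify.
apply: cint_mxact; first by move=> x; exact: nrmsq_realify.
apply: cmeasM => //; apply: cmeas_real; apply: kmeas_expR; apply: kmeasM; last exact: kmeas_cst.
by apply: kmeasN; exact: kmeas_nrmsq.
Qed.

End GaussianInvariance.

(** * Symbols and star products under the group action *)

Section Symbols.
Context {R : realType}.
Notation C := R[i].
Variables (c : nm_case) (hbar : R).
Notation n := (ndim c).
Notation m := (mdim c).
Notation PhiZ := (PhiR R c hbar).
Implicit Types (A B : ((nat -> R) -> C) -> ((nat -> R) -> C)).

Lemma L2_PhiZ z : L2 R n (PhiZ z). Proof. exact: L2_Phi. Qed.

(* Where Q(u, u) = 0 both symbols have the junk value 0, but then Phi_u vanishes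
   in L^2, and so do the numerators. *)
Lemma ext_symbol_inj A B : bounded_op R n A -> bounded_op R n B ->
  symbol R c hbar A = symbol R c hbar B -> ext_symbol R c hbar A = ext_symbol R c hbar B.
Proof.
move=> bA bB sAB; apply/funext => w; apply/funext => z; rewrite /ext_symbol; congr (_ / _).
have bD := bounded_formB _ _ (bounded_form_op _ bA) (bounded_form_op _ bB).
apply/eqP; rewrite -subr_eq0; apply/eqP; apply: (form_diag0 hbar _ bD) => u.
have := congr1 (fun f => f u) sAB; rewrite /symbol /ext_symbol.
have [Q0 _|Q0 /(mulIf (invr_neq0 Q0)) ->] := eqVneq (ip R n (PhiZ u) (PhiZ u)) 0; last by rewrite subrr.
have p0 := ip_diag0 _ (L2_PhiZ u) Q0.
have ip0 D : bounded_op R n D -> ip R n (D (PhiZ u)) (PhiZ u) = 0.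
  case=> DL _ _; rewrite (ipJ _ _ (L2_PhiZ u) (DL _ (L2_PhiZ u))) (l2norm0_ip _ _ _ _ p0) ?conjc0 //.
    exact: L2_PhiZ.
  by apply: DL; exact: L2_PhiZ.
by rewrite !ip0 // subrr.
Qed.

Lemma cmeas_ext_symbol_l A w : bounded_op R n A ->
  cmeas (2 * m) (fun x => ext_symbol R c hbar A w (toCv R m x)).
Proof.
move=> bA; apply: cmeasM.
  exact: (cmeas_form hbar _ (bounded_form_op _ bA) _ (L2_PhiZ w)).
apply: cmeasV; exact: (cmeas_form hbar _ bounded_form_ip _ (L2_PhiZ w)).
Qed.

Lemma cmeas_ip_r psi : L2 R n psi -> cmeas (2 * m) (fun x => ip R n psi (PhiZ (toCv R m x))).
Proof.
move=> L; have := cmeas_form hbar _ (bounded_form_flip _ bounded_form_ip) _ L.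
by move=> /cmeasJ; under eq_fun do rewrite conjcK.
Qed.

Lemma cmeas_ext_symbol_r A z : bounded_op R n A ->
  cmeas (2 * m) (fun x => ext_symbol R c hbar A (toCv R m x) z).
Proof.
move=> [AL _ _]; apply: cmeasM; first by apply: cmeas_ip_r; apply: AL; exact: L2_PhiZ.
by apply: cmeasV; apply: cmeas_ip_r; exact: L2_PhiZ.
Qed.

Variables (g : Fgrp R c).
Hypothesis hg : in_F R c g.
Notation L := (Lact R c g).

Lemma symbol_covariant A : bounded_op R n A -> exists B, bounded_op R n B /\
  forall w z, ext_symbol R c hbar B w z = ext_symbol R c hbar A (L w) (L z).
Proof.
move=> bA; have [M [MM ME]] := rho_equivariant c g hg.
have MMt : M^T^T *m M^T = 1%:M by rewrite trmxK; exact: mulmx1C.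
(* M acts on the parameter of the coherent state, hence M^T on the point of the sphere; composition
   with M undoes this. *)
have PhiL z : PhiZ (L z) = rotfun M^T (PhiZ z) by rewrite /PhiR ME Phi_mulmx.
have PhiLK z : rotfun M (PhiZ (L z)) = PhiZ z.
  have := Phi_mulmx M^T hbar (rho R c (L z)); rewrite trmxK => <-.
  by rewrite ME mulmxA -map_mxM MM map_mx1 mul1mx.
exists (conj_op M A); split; first exact: bounded_op_conj.
move=> w z; rewrite /ext_symbol; have [AL _ _] := bA.
have E1 : ip R n (conj_op M A (PhiZ z)) (PhiZ w) = ip R n (A (PhiZ (L z))) (PhiZ (L w)).
  have LA := AL _ (L2_PhiZ (L z)).
  apply: etrans (ip_rot M MM _ _ LA (L2_PhiZ (L w))).
  exact: (f_equal2 (fun p q => ip R n (rotfun M (A p)) q) (esym (PhiL z)) (esym (PhiLK w))).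
have E := etrans (esym (f_equal2 (ip R n) (PhiLK z) (PhiLK w)))
  (ip_rot M MM _ _ (L2_PhiZ (L z)) (L2_PhiZ (L w))).
exact: (f_equal2 (fun p q => p / q) E1 E).
Qed.

Lemma Qk_covariant u z : Qk R c hbar (L u) (L z) = Qk R c hbar u z.
Proof.
have [M [MM ME]] := rho_equivariant c g hg.
have MMt : M^T^T *m M^T = 1%:M by rewrite trmxK; exact: mulmx1C.
have PhiL y : PhiZ (L y) = rotfun M^T (PhiZ y) by rewrite /PhiR ME Phi_mulmx.
exact: (etrans (f_equal2 (ip R n) (PhiL z) (PhiL u))
  (ip_rot M^T MMt _ _ (L2_PhiZ z) (L2_PhiZ u))).
Qed.

Lemma in_A_comp (f : 'cV[C]_m -> C) : in_A R c hbar f -> in_A R c hbar (f \o L).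
Proof.
move=> [A [bA ->]]; have [B [bB hB]] := symbol_covariant A bA.
exists B; split; first exact: bB.
by apply/funext => z; exact: esym (hB z z).
Qed.

Lemma star_covariant A1 A2 B1 B2 : bounded_op R n A1 -> bounded_op R n A2 ->
  (forall w z, ext_symbol R c hbar B1 w z = ext_symbol R c hbar A1 (L w) (L z)) ->
  (forall w z, ext_symbol R c hbar B2 w z = ext_symbol R c hbar A2 (L w) (L z)) ->
  star R c hbar (ext_symbol R c hbar B1) (ext_symbol R c hbar B2)
  = star R c hbar (ext_symbol R c hbar A1) (ext_symbol R c hbar A2) \o L.
Proof.
move=> bA1 bA2 h1 h2; apply/funext => z.
pose F u := ext_symbol R c hbar A1 (L z) u * ext_symbol R c hbar A2 u (L z) *
  (Qk R c hbar u (L z) * (Qk R c hbar u (L z))^* / Qk R c hbar (L z) (L z)).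
have mF : cmeas (2 * m) (fun x => F (toCv R m x)).
  apply: cmeasM; first apply: cmeasM.
  - exact: (cmeas_ext_symbol_l A1 (L z) bA1).
  - exact: (cmeas_ext_symbol_r A2 (L z) bA2).
  - have mQ : cmeas (2 * m) (fun x => Qk R c hbar (toCv R m x) (L z)).
      exact: (cmeas_ip_r _ (L2_PhiZ (L z))).
    apply: cmeasM; last exact: cmeas_cst.
    by apply: cmeasM; [exact: mQ|exact: cmeasJ].
(* By covariance of the symbols and of the kernel, the integrand at u is F (L u); the unitary
   substitution then removes L. *)
transitivity (mu_int R hbar (fun u => F (L u))); last first.
  exact: (mu_int_unitary m hbar (Lmat R c g) F (Lmat_unitary c g hg) mF).
have E u : ext_symbol R c hbar B1 z u * ext_symbol R c hbar B2 u z *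
    (Qk R c hbar u z * (Qk R c hbar u z)^* / Qk R c hbar z z) = F (L u).
  by rewrite h1 h2 -(Qk_covariant u z) -(Qk_covariant z z).
exact: (congr1 (mu_int R hbar) (funext E)).
Qed.

End Symbols.

(** The star product is computed from extended symbols, so covariance is claimed for all operators
    representing the four symbols; [ext_symbol_inj] makes the choice immaterial. *)
Theorem theorem5p2 (R : realType) (c : nm_case) (hbar : R) (hhbar : 0 < hbar)
  (g : Fgrp R c) (hg : in_F R c g)
  (f1 f2 : 'cV[R[i]]_(mdim c) -> R[i]) :
  in_A R c hbar f1 -> in_A R c hbar f2 ->
  [/\ in_A R c hbar (f1 \o Lact R c g),
      in_A R c hbar (f2 \o Lact R c g) &
      forall A1 A2 B1 B2,
        bounded_op R (ndim c) A1 -> bounded_op R (ndim c) A2 ->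
        bounded_op R (ndim c) B1 -> bounded_op R (ndim c) B2 ->
        f1 = symbol R c hbar A1 -> f2 = symbol R c hbar A2 ->
        f1 \o Lact R c g = symbol R c hbar B1 ->
        f2 \o Lact R c g = symbol R c hbar B2 ->
        star R c hbar (ext_symbol R c hbar B1) (ext_symbol R c hbar B2)
        = star R c hbar (ext_symbol R c hbar A1) (ext_symbol R c hbar A2) \o Lact R c g].
Proof.
move=> hf1 hf2; split; [exact: in_A_comp|exact: in_A_comp|].
move=> A1 A2 B1 B2 bA1 bA2 bB1 bB2 f1A f2A f1B f2B.
have covariant A B f : bounded_op R (ndim c) A -> bounded_op R (ndim c) B ->
    f = symbol R c hbar A -> f \o Lact R c g = symbol R c hbar B ->
    forall w z, ext_symbol R c hbar B w z = ext_symbol R c hbar A (Lact R c g w) (Lact R c g z).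
  (* B and the conjugate B' of A both have the symbol f o L, hence the same extended symbol. *)
  move=> bA bB fA fB w z; have [B' [bB' hB']] := symbol_covariant c hbar g hg A bA.
  have sBB' : symbol R c hbar B = symbol R c hbar B'.
    by rewrite -fB fA; apply/funext => u; exact: esym (hB' u u).
  by rewrite (ext_symbol_inj c hbar B B' bB bB' sBB') hB'.
exact: (star_covariant c hbar g hg A1 A2 B1 B2 bA1 bA2
  (covariant A1 B1 f1 bA1 bB1 f1A f1B) (covariant A2 B2 f2 bA2 bB2 f2A f2B)).
Qed.
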